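(* Let $p>5$ be a prime and $r$ a positive integer. Then \[ \sum_{\substack{i_{1}+\cdots+i_{5}=2p^{r}\\ i_{1},\dots,i_{5}\in \mathcal{P}_{p}}}\frac{(-1)^{i_{1}}}{i_{1}i_{2}i_{3}i_{4}i_{5}}+2\sum_{\substack{i_{1}+\cdots+i_{5}=2p^{r}\\ i_{1},\dots,i_{5}\in \mathcal{P}_{p}}}\frac{(-1)^{i_{1}+i_{2}}}{i_{1}i_{2}i_{3}i_{4}i_{5}} \equiv\begin{cases} 12B_{p-5}\pmod{p}, & \text{if } r=1,\\ 6p^{r-1}B_{p-5}\pmod{p^{r}}, & \text{if } r>1. \end{cases} \]
   Context: $\mathcal{P}_{n}$ denotes the set of positive integers coprime to $n$; the sums run over ordered 5-tuples of positive integers, each coprime to $p$, with the indicated sum. The Bernoulli numbers $B_k$ are defined by $B_0=1$ and $\sum_{i=0}^{n}\binom{n+1}{i}B_{i}=0$ for $n\geq 1$. Congruences between rational numbers whose denominators are coprime to $p$ are understood in the ring of $p$-integral rationals: $a\equiv b \pmod{p^s}$ means $(a-b)/p^s$ has denominator coprime to $p$. *)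

(* Defs.v *)
From mathcomp Require Import all_boot all_order all_algebra.
Set Implicit Arguments.
Unset Strict Implicit.
Unset Printing Implicit Defensive.
Import Order.TTheory GRing.Theory Num.Theory.
Local Open Scope ring_scope.

Definition coprime_pos (n : nat) : pred nat :=
  fun i => (0 < i)%N && coprime i n.

(* B_0, ..., B_(n-1): the defining relation is solved for its last term, since
   \sum_(i < m.+1) 'C(m.+1, i) B_i equals 1 for m = 0 and 0 for m >= 1. *)
Fixpoint bernoulli_seq (n : nat) : seq rat :=
  if n is m.+1 then
    let s := bernoulli_seq m in
    rcons s (((m == 0%N)%:R - \sum_(i < m) 'C(m.+1, i)%:R * s`_i) / m.+1%:R)
  else [::].

Definition bernoulli (n : nat) : rat := (bernoulli_seq n.+1)`_n.

Lemma size_bernoulli_seq n : size (bernoulli_seq n) = n.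
Proof. by elim: n => //= n IHn; rewrite size_rcons IHn. Qed.

Lemma nth_bernoulli_seq n i : (i < n)%N -> (bernoulli_seq n)`_i = bernoulli i.
Proof.
elim: n => // n IHn; rewrite ltnS leq_eqVlt => /predU1P[-> // | lt_in].
by rewrite /= nth_rcons size_bernoulli_seq lt_in IHn.
Qed.

Lemma bernoulliE n : \sum_(i < n.+1) 'C(n.+1, i)%:R * bernoulli i = (n == 0%N)%:R.
Proof.
rewrite big_ord_recr /= binSn.
rewrite {2}/bernoulli /= nth_rcons size_bernoulli_seq ltnn eqxx.
rewrite mulrC divfK ?pnatr_eq0 //.
rewrite (eq_bigr (fun i : 'I_n => 'C(n.+1, i)%:R * (bernoulli_seq n)`_i)).
  by rewrite addrC subrK.
by move=> i _; rewrite nth_bernoulli_seq.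
Qed.

Lemma bernoulli0 : bernoulli 0 = 1.
Proof. by have := bernoulliE 0; rewrite big_ord1 bin0 mul1r. Qed.

Lemma bernoulli_rec n :
  (1 <= n)%N -> \sum_(i < n.+1) 'C(n.+1, i)%:R * bernoulli i = 0.
Proof. by case: n => // n _; rewrite bernoulliE. Qed.

Definition eqmodpq (p s : nat) (a b : rat) : Prop :=
  coprime `|denq ((a - b) / (p ^ s)%:R)|%N p.

(* A 5-tuple of positive integers of sum N has entries at most N, so bounding
   the entries by 'I_N.+1 loses nothing. The indices are 0, ..., 4, so that
   (i 0, i 1) stands for (i_1, i_2). *)
Definition sum5 (p N : nat) (w : {ffun 'I_5 -> 'I_N.+1} -> rat) : rat :=
  \sum_(i : {ffun 'I_5 -> 'I_N.+1}
        | [forall k, coprime_pos p (i k)] && (\sum_k (i k : nat) == N)%N)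
    w i / \prod_k (i k)%:R.

(* Main.v *)
(* Let Z(N) be the sum of 1/(i_1 ... i_5) over the 5-tuples of sum N with entries coprime
   to p, that is the coefficient of x^N in f^5 with f = \sum_(p does not divide i) x^i/i.
   Since f(x) + f(-x) = f(x^2), five times the signed sum is Z(p^r)/2 - Z(2 p^r).

   For r = 1 the sums over all tuples are elementary symmetric functions of 1/i, so
   Newton's identities express Z(p) and Z(2p) through the power sums of 1/i; those reduce
   to \sum_(i < p) 1/i^4 = (4/5) p B_(p-5) modulo p^2, and Z(p) = -24 B_(p-5),
   Z(2p) = -72 B_(p-5) modulo p.

   For the step from q = p^r to p q, write i = a + q b with 0 < a < q. Expanding 1/i to first
   order in q gives Z(n q) = \sum_c 'C(n + 4 - c, 4) S_c modulo q, where S_c is the part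
   of the sum over tuples a of sum c q (1 <= c <= 4). If p divides n, the binomials are
   divisible by p and the congruence holds modulo p q. The symmetry a -> q - a gives
   S_(5-c) = - S_c modulo q, hence Z(m p q) = m p (8 Z(q) - Z(2 q))/6 modulo p q. *)
Require Import Defs.
From HB Require Import structures.
From mathcomp Require Import all_boot all_order all_algebra.
From mathcomp Require Import ring zify.
Set Implicit Arguments.
Unset Strict Implicit.
Unset Printing Implicit Defensive.
Import Order.TTheory GRing.Theory Num.Theory.
Local Open Scope ring_scope.

(** * Congruences modulo powers of p *)

Definition pint (p : nat) : {pred rat} := fun x => coprime `|denq x|%N p.

(** The reduced denominator divides every d that clears x, so any such d coprime to p is a valid
    witness; the closure properties follow from this. *)
Lemma pintP (p : nat) (x : rat) :
  reflect (exists2 d : nat, coprime d p & x * d%:R \is a Num.int) (x \in pint p).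
Proof.
apply: (iffP idP) => [cdp | [d cdp /intrP[a xdE]]].
  exists `|denq x|%N => //.
  have -> : (`|denq x|%N%:R : rat) = (denq x)%:~R.
    by rewrite pmulrn abszE gtr0_norm ?denq_gt0.
  by rewrite mulrC -{2}[x]divq_num_den mulrCA divff ?intr_eq0 ?denq_eq0 // mulr1 rpred_int.
rewrite unfold_in; apply: coprime_dvdl cdp.
have eqz : numq x * d%:Z = a * denq x.
  apply: (@intr_inj rat); rewrite !intrM -xdE -{2}[x]divq_num_den pmulrn.
  by rewrite mulrAC divfK ?intr_eq0 ?denq_eq0.
have : (denq x %| numq x * d%:Z)%Z by rewrite eqz dvdz_mull.
by rewrite Gauss_dvdzr // coprimez_sym /coprimez; apply: coprime_num_den.
Qed.

Fact pint_subring_closed p : subring_closed (pint p).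
Proof.
split=> [|x y /pintP[d cd dx] /pintP[e ce ey]|x y /pintP[d cd dx] /pintP[e ce ey]].
- by apply/pintP; exists 1%N; rewrite ?coprime1n // mulr1.
- apply/pintP; exists (d * e)%N; first by rewrite coprimeMl cd.
  have -> : (x - y) * (d * e)%:R = x * d%:R * e%:R - y * e%:R * d%:R.
    by rewrite natrM; ring.
  by rewrite rpredB // rpredM // rpred_nat.
- apply/pintP; exists (d * e)%N; first by rewrite coprimeMl cd.
  have -> : x * y * (d * e)%:R = x * d%:R * (y * e%:R) by rewrite natrM; ring.
  by rewrite rpredM.
Qed.

HB.instance Definition _ p :=
  GRing.isSubringClosed.Build rat (pint p) (pint_subring_closed p).

Lemma pint_invn p d : coprime d p -> d%:R^-1 \in pint p.
Proof.
move=> cd; apply/pintP; exists d => //.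
by have [->|d0] := eqVneq d 0%N; [rewrite mulr0 rpred0 | rewrite mulVf ?pnatr_eq0].
Qed.

Ltac pint_closed := match goal with
  | H : is_true (in_mem ?x ?S) |- is_true (in_mem ?x ?S) => exact H
  | |- is_true (in_mem (?x + ?y) _) => apply: rpredD; pint_closed
  | |- is_true (in_mem (- ?x) _) => rewrite rpredN; pint_closed
  | |- is_true (in_mem (?x * ?y) _) => apply: rpredM; pint_closed
  | |- is_true (in_mem (?x ^+ _) _) => apply: rpredX; pint_closed
  | |- is_true (in_mem 1 _) => exact: rpred1
  | |- is_true (in_mem (_%:R) _) => exact: rpred_nat
  | |- is_true (in_mem (_%:R^-1) _) => apply: pint_invn; assumption
  end.

(** The ideal generated by p^s in the ring of p-integral rationals; [eqmodpq p s a b] unfolds to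
    [a - b \in pdvd p s]. *)
Definition pdvd (p s : nat) : {pred rat} := fun x => x / (p ^ s)%:R \in pint p.

Lemma pdvdE p s x : (x \in pdvd p s) = (x / (p ^ s)%:R \in pint p).
Proof. by []. Qed.

Fact pdvd_zmod_closed p s : zmod_closed (pdvd p s).
Proof.
split=> [|x y]; rewrite !pdvdE ?mul0r ?rpred0 // mulrBl.
exact: rpredB.
Qed.

HB.instance Definition _ p s :=
  GRing.isZmodClosed.Build rat (pdvd p s) (pdvd_zmod_closed p s).

Lemma pdvd0 p x : (x \in pdvd p 0) = (x \in pint p).
Proof. by rewrite pdvdE expn0 divr1. Qed.

Section PAdic.

Variable p : nat.
Hypothesis p_pr : prime p.

Lemma pX_neq0 s : (p ^ s)%:R != 0 :> rat.
Proof. by rewrite pnatr_eq0 expn_eq0 negb_and -lt0n prime_gt0. Qed.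

Lemma pdvdP s x :
  reflect (exists2 y, y \in pint p & x = (p ^ s)%:R * y) (x \in pdvd p s).
Proof.
apply: (iffP idP) => [px | [y py ->]].
  by exists (x / (p ^ s)%:R); rewrite ?px // mulrC divfK ?pX_neq0.
by rewrite pdvdE mulrC mulKf ?pX_neq0.
Qed.

Lemma pdvdM s t x y : x \in pdvd p s -> y \in pdvd p t -> x * y \in pdvd p (s + t).
Proof.
move=> /pdvdP[a pa ->] /pdvdP[b pb ->]; apply/pdvdP; exists (a * b).
  by rewrite rpredM.
by rewrite expnD natrM; ring.
Qed.

Lemma pdvdMl s x y : x \in pint p -> y \in pdvd p s -> x * y \in pdvd p s.
Proof. by move=> px py; rewrite -[s]add0n pdvdM ?pdvd0. Qed.

Lemma pdvdMr s x y : x \in pdvd p s -> y \in pint p -> x * y \in pdvd p s.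
Proof. by move=> px py; rewrite mulrC pdvdMl. Qed.

Lemma pdvd_pX s : (p ^ s)%:R \in pdvd p s.
Proof. by apply/pdvdP; exists 1; rewrite ?rpred1 ?mulr1. Qed.

Lemma pdvd_p : p%:R \in pdvd p 1.
Proof. by have := pdvd_pX 1; rewrite expn1. Qed.

Lemma pdvdW s t x : (s <= t)%N -> x \in pdvd p t -> x \in pdvd p s.
Proof.
move=> st /pdvdP[y py ->]; apply/pdvdP; exists ((p ^ (t - s))%:R * y).
  by rewrite rpredM ?rpred_nat.
by rewrite mulrA -natrM -expnD subnKC.
Qed.

Lemma pdvd_pint s x : x \in pdvd p s -> x \in pint p.
Proof. by rewrite -pdvd0; apply: pdvdW. Qed.

Lemma pdvd_div s t x : (x / (p ^ t)%:R \in pdvd p s) = (x \in pdvd p (s + t)).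
Proof.
by rewrite !pdvdE expnD natrM invfM mulrAC mulrA.
Qed.

Lemma pdvd_divp s x : (x / p%:R \in pdvd p s) = (x \in pdvd p s.+1).
Proof. by have := pdvd_div s 1 x; rewrite expn1 addn1. Qed.

(** Since 1/d is p-integral, constants prime to p such as 2, 5 or 24 may be cleared before a
    congruence is proved. *)
Lemma pdvd_cancel s d x : coprime d p -> d%:R * x \in pdvd p s -> x \in pdvd p s.
Proof.
move=> cd pdx; have d0 : d%:R != 0 :> rat.
  rewrite pnatr_eq0; apply: contraTneq cd => ->.
  by rewrite /coprime gcd0n neq_ltn (prime_gt1 p_pr) orbT.
by rewrite -[x](mulKf d0) pdvdMl ?pint_invn.
Qed.

Lemma pdvd_subX s n x y : x \in pint p -> y \in pint p ->
  x - y \in pdvd p s -> x ^+ n - y ^+ n \in pdvd p s.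
Proof.
move=> px py pxy; rewrite subrXX pdvdMr // rpred_sum // => i _.
by rewrite rpredM ?rpredX.
Qed.

(** The cofactor of x - y in x^p - y^p is a sum of p terms, each y^(p-1) modulo p, so it supplies
    the second factor p. *)
Lemma pdvd_subXp x y : x \in pint p -> y \in pint p ->
  x - y \in pdvd p 1 -> x ^+ p - y ^+ p \in pdvd p 2.
Proof.
move=> px py pxy; rewrite subrXX -[2%N]/(1 + 1)%N pdvdM //.
have -> : \sum_(i < p) x ^+ (p.-1 - i) * y ^+ i =
   \sum_(i < p) (x ^+ (p.-1 - i) - y ^+ (p.-1 - i)) * y ^+ i + p%:R * y ^+ p.-1.
  rewrite -[in p%:R](card_ord p) -sumr_const mulr_suml -big_split /=.
  apply: eq_bigr => i _; rewrite mul1r mulrBl -addrA -exprD subnK ?addNr ?addr0 //.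
  by rewrite -ltnS prednK ?prime_gt0.
rewrite rpredD ?pdvdMr ?pdvd_p ?rpredX // rpred_sum // => i _.
by rewrite pdvdMr ?rpredX // pdvd_subX.
Qed.

Lemma coprime_small d : (0 < d)%N -> (d < p)%N -> coprime d p.
Proof.
move=> d0 dp; rewrite coprime_sym prime_coprime //.
by apply: contraTN dp => /(dvdn_leq d0); rewrite -leqNgt.
Qed.

(** The recursion yields B_j after division by j + 1 < p, so strong induction introduces only
    denominators prime to p. *)
Lemma bernoulli_pint j : (j.+1 < p)%N -> bernoulli j \in pint p.
Proof.
elim/ltn_ind: j => j IH jp; have := bernoulliE j.
rewrite big_ord_recr /= binSn => /eqP; rewrite addrC -subr_eq0 addrAC => E.
rewrite -pdvd0 (@pdvd_cancel 0 j.+1) ?coprime_small // pdvd0.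
move: E; rewrite addrAC -addrA addr_eq0 => /eqP ->.
rewrite rpredN rpredB ?rpred_nat // rpred_sum // => i _.
by rewrite rpredM ?rpred_nat // IH //; have := ltn_ord i; lia.
Qed.

End PAdic.

(** * Faulhaber's formula *)

Lemma mul_binC n j l : (j + l <= n)%N ->
  ('C(n, j) * 'C(n - j, l) = 'C(n, l) * 'C(n - l, j))%N.
Proof.
move=> jln; apply/eqP.
rewrite -(@eqn_pmul2r (j`! * l`! * (n - j - l)`!)) ?muln_gt0 ?fact_gt0 //; apply/eqP.
have E a b : (a + b <= n)%N ->
    ('C(n, a) * 'C(n - a, b) * (a`! * b`! * (n - a - b)`!) = n`!)%N.
  move=> ab; have ha : (a <= n)%N by lia.
  have hb : (b <= n - a)%N by lia.
  rewrite -(bin_fact ha) -(bin_fact hb).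
  by rewrite -!mulnA; congr (_ * _)%N; rewrite mulnCA.
by rewrite E // [(j`! * _)%N]mulnC subnAC E // addnC.
Qed.

(** By induction on m it suffices that raising m by one increases the right side by (n+1) m^n, as
    for Bernoulli polynomials. *)
Lemma faulhaber n m :
  n.+1%:R * \sum_(i < m) i%:R ^+ n
    = \sum_(j < n.+1) 'C(n.+1, j)%:R * bernoulli j * m%:R ^+ (n.+1 - j).
Proof.
elim: m => [|m IH].
  rewrite big_ord0 mulr0 big1 // => j _.
  by rewrite expr0n subn_eq0 leqNgt ltn_ord /= mulr0.
rewrite big_ord_recr /= mulrDr IH; apply/eqP; rewrite eq_sym addrC -subr_eq -sumrB.
apply/eqP.
(* The binomial theorem expands (m+1)^(n+1-j); the guard drops its top term, which the subtracted
   m^(n+1-j) cancels. *)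
transitivity (\sum_(j < n.+1) \sum_(l < n.+1) (if (l + j < n.+1)%N then
    'C(n.+1, l)%:R * m%:R ^+ l * ('C(n.+1 - l, j)%:R * bernoulli j) else 0)).
  apply: eq_bigr => j _; rewrite -mulrBr -nat1r exprDn big_ord_recr /=.
  rewrite subnn expr0 mul1r binn mulr1n addrK mulr_sumr.
  rewrite (big_ord_widen n.+1 (fun l => 'C(n.+1, j)%:R * bernoulli j
     * (1 ^+ (n.+1 - j - l) * m%:R ^+ l *+ 'C(n.+1 - j, l)))) ?leq_subr //.
  rewrite big_mkcond /=; apply: eq_bigr => l _.
  rewrite ltn_subRL addnC; case: ifP => // jl.
  rewrite expr1n mul1r -(mulr_natr (m%:R ^+ l)).
  have E : 'C(n.+1, j)%:R * 'C(n.+1 - j, l)%:R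
      = 'C(n.+1, l)%:R * 'C(n.+1 - l, j)%:R :> rat.
    by rewrite -!natrM mul_binC //; lia.
  transitivity ('C(n.+1, j)%:R * 'C(n.+1 - j, l)%:R * (bernoulli j * m%:R ^+ l)).
    by rewrite [RHS]mulrACA [in RHS](mulrC 'C(_, l)%:R).
  by rewrite E [bernoulli j * _]mulrC mulrACA.
rewrite exchange_big /=.
(* The coefficient of m^l contains a full Bernoulli recursion sum, which by [bernoulliE] vanishes
   unless l = n. *)
transitivity (\sum_(l < n.+1) 'C(n.+1, l)%:R * m%:R ^+ l * (n - l == 0)%N%:R : rat).
  apply: eq_bigr => l _; have ln : (l <= n)%N by rewrite -ltnS.
  rewrite -bernoulliE -(subSn ln) mulr_sumr.
  rewrite (big_ord_widen n.+1 (fun j => 'C(n.+1, l)%:R * m%:R ^+ l *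
     ('C(n.+1 - l, j)%:R * bernoulli j))) ?leq_subr // [RHS]big_mkcond /=.
  by apply: eq_bigr => j _; rewrite ltn_subRL.
rewrite big_ord_recr /= subnn eqxx mulr1 binSn big1 ?add0r // => l _.
by rewrite subn_eq0 leqNgt ltn_ord mulr0.
Qed.

(** * Power sums of reciprocals *)

Definition psum (p j n : nat) : rat :=
  \sum_(1 <= i < n | coprime i p) i%:R^-1 ^+ j.

Section PowerSums.

Variable p : nat.
Hypothesis p_pr : prime p.

Lemma coprime_subMp m i : (i <= m * p)%N -> coprime (m * p - i) p = coprime i p.
Proof.
by move=> im; rewrite !(coprime_sym _ p) !prime_coprime // dvdn_subr // dvdn_mull.
Qed.

Lemma pdvd_mulp m : (m * p)%:R \in pdvd p 1.
Proof. by rewrite natrM pdvdMl ?rpred_nat ?pdvd_p. Qed.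

Lemma pdvd_sum_coprime s n F :
  (forall i, (0 < i < n)%N -> coprime i p -> F i \in pdvd p s) ->
  \sum_(1 <= i < n | coprime i p) F i \in pdvd p s.
Proof.
by move=> HF; rewrite big_nat_cond rpred_sum // => i /andP[]; apply: HF.
Qed.

Lemma sum_coprime_rev m (G : nat -> rat) :
  \sum_(1 <= i < m * p | coprime i p) G (m * p - i)%N
    = \sum_(1 <= i < m * p | coprime i p) G i.
Proof.
rewrite [RHS]big_nat_rev [LHS]big_nat_cond [RHS]big_nat_cond; apply: eq_big => i.
  rewrite add1n subSS; case: (boolP (0 < i < _)%N) => //= /andP[_ im].
  by rewrite coprime_subMp // ltnW.
by rewrite add1n subSS.
Qed.

Lemma psum_pint j n : psum p j n \in pint p.
Proof.
by rewrite rpred_sum // => i ci; rewrite rpredX // pint_invn.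
Qed.

Lemma psum_add_rev m j :
  2 * psum p j (m * p) = \sum_(1 <= i < m * p | coprime i p)
     (i%:R^-1 ^+ j + ((m * p)%:R - i%:R)^-1 ^+ j).
Proof.
rewrite big_split /= mulr_natl mulr2n /psum; congr (_ + _).
rewrite -[LHS](@sum_coprime_rev m (fun i => i%:R^-1 ^+ j)).
rewrite [LHS]big_nat_cond [RHS]big_nat_cond; apply: eq_bigr => i /andP[/andP[_ im] _].
by rewrite natrB // ltnW.
Qed.

Lemma inv_rev_pint m i : (0 < i < m * p)%N -> coprime i p ->
  ((m * p)%:R - i%:R)^-1 \in pint p.
Proof.
case/andP=> i0 im ci; have im' := ltnW im.
by rewrite -natrB // pint_invn // coprime_subMp.
Qed.

Lemma inv_rev_neq0 m i : (0 < i < m * p)%N ->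
  (i%:R != 0 :> rat) /\ ((m * p)%:R - i%:R != 0 :> rat).
Proof.
case/andP=> i0 im; have im' := ltnW im.
by rewrite -natrB // !pnatr_eq0 -lt0n i0 subn_eq0 -ltnNge.
Qed.

(** For u = 1/i and v = 1/(m p - i), u + v = m p u v, and u + v divides u^5 + v^5. *)
Lemma psum5_pdvd m : odd p -> psum p 5 (m * p) \in pdvd p 1.
Proof.
move=> p_odd; apply: (@pdvd_cancel p p_pr 1 2); first by rewrite coprime2n.
rewrite psum_add_rev; apply: pdvd_sum_coprime => i im ci.
have [i0 n0] := inv_rev_neq0 im; have iv := inv_rev_pint im ci.
have iu := pint_invn ci; have pn := pdvd_mulp m.
move: ((m * p)%:R) n0 iv pn => n n0 iv pn.
set u := i%:R^-1 in iu *; set v := (n - _)^-1 in iv *.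
have E : u + v = n * (u * v) by rewrite /u /v; field; rewrite i0 n0.
have -> : u ^+ 5 + v ^+ 5 =
    (u + v) * (u ^+ 4 - u ^+ 3 * v + u ^+ 2 * v ^+ 2 - u * v ^+ 3 + v ^+ 4) by ring.
rewrite E -mulrA pdvdMr //; pint_closed.
Qed.

(** With n = m p, 1/(n - i) = -1/i - n/i^2 modulo n^2, so pairing i with n - i makes twice the sum
    equal to -n times the sum of squares modulo p^2. *)
Lemma psum1_pdvd m : odd p -> psum p 2 (m * p) \in pdvd p 1 ->
  psum p 1 (m * p) \in pdvd p 2.
Proof.
move=> p_odd P2; apply: (@pdvd_cancel p p_pr 2 2); first by rewrite coprime2n.
have -> : 2 * psum p 1 (m * p) =
    (2 * psum p 1 (m * p) + (m * p)%:R * psum p 2 (m * p))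
    - (m * p)%:R * psum p 2 (m * p) by ring.
rewrite rpredB ?(@pdvdM p p_pr 1 1) ?pdvd_mulp //.
rewrite psum_add_rev /psum mulr_sumr -big_split /=.
apply: pdvd_sum_coprime => i im ci.
have [i0 n0] := inv_rev_neq0 im; have iv := inv_rev_pint im ci.
have iu := pint_invn ci; have pn := pdvd_mulp m.
move: ((m * p)%:R) n0 iv pn => n n0 iv pn.
have -> : i%:R^-1 ^+ 1 + (n - i%:R)^-1 ^+ 1 + n * i%:R^-1 ^+ 2
   = n * n * (i%:R^-1 ^+ 2 * (n - i%:R)^-1) by field; rewrite i0 n0.
rewrite pdvdMr ?(@pdvdM p p_pr 1 1) //; pint_closed.
Qed.

(** With n = m p, 1/(n - i)^3 = -1/i^3 - 3n/i^4 - 6n^2/i^5 modulo n^3; [psum5_pdvd] absorbs the n^2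
    term. *)
Lemma psum3_pdvd m : odd p ->
  2 * psum p 3 (m * p) + 3 * (m * p)%:R * psum p 4 (m * p) \in pdvd p 3.
Proof.
move=> p_odd; have pn := pdvd_mulp m; have P5 := psum5_pdvd m p_odd.
set n := (m * p)%:R in pn *.
have -> : 2 * psum p 3 (m * p) + 3 * n * psum p 4 (m * p) =
    (2 * psum p 3 (m * p) + 3 * n * psum p 4 (m * p)
      + 6 * (n * n) * psum p 5 (m * p)) - 6 * (n * n) * psum p 5 (m * p) by ring.
have pnn : n * n \in pdvd p 2 by apply: (@pdvdM p p_pr 1 1).
rewrite rpredB //; last first.
  by rewrite (@pdvdM p p_pr 2 1) // pdvdMl // rpred_nat.
rewrite psum_add_rev /psum !mulr_sumr -!big_split /=.
apply: pdvd_sum_coprime => i im ci.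
have [i0 n0] := inv_rev_neq0 im; have iv := inv_rev_pint im ci.
have iu := pint_invn ci; rewrite -/n in n0 iv *; move: n pn pnn n0 iv => n pn pnn n0 iv.
(* With t = n/i, the cofactor comes from 1 - (1 + 3t + 6t^2)(1 - t)^3 = t^3 (10 - 15t + 6t^2). *)
have -> : i%:R^-1 ^+ 3 + (n - i%:R)^-1 ^+ 3 + 3 * n * i%:R^-1 ^+ 4
   + 6 * (n * n) * i%:R^-1 ^+ 5 = n * n * n * ((n - i%:R)^-1 ^+ 3 * i%:R^-1 ^+ 3 *
     (10 - 15 * (n * i%:R^-1) + 6 * (n * i%:R^-1) ^+ 2)) by field; rewrite i0 n0.
rewrite pdvdMr ?(@pdvdM p p_pr 2 1) //; have := pdvd_pint p_pr pn => ?; pint_closed.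
Qed.

Lemma psum_double j : psum p j (2 * p) = psum p j p
  + \sum_(1 <= i < p | coprime i p) (p%:R + i%:R)^-1 ^+ j.
Proof.
have p0 := prime_gt0 p_pr.
rewrite {1}/psum (@big_cat_nat _ _ _ p) //=; last by lia.
congr (_ + _); rewrite [LHS]big_ltn_cond; last by lia.
have /negbTE-> : ~~ coprime p p by rewrite prime_coprime // dvdnn.
rewrite -[p.+1]addn1 addnC big_addn.
have -> : (2 * p - p = p)%N by lia.
apply: eq_big => i; first by rewrite /coprime gcdnC gcdnDr gcdnC.
by rewrite natrD addrC.
Qed.

Lemma psum_double_pdvd j : psum p j (2 * p) - 2 * psum p j p \in pdvd p 1.
Proof.
rewrite psum_double.
set X := \sum_(1 <= i < p | _) _.
have -> : psum p j p + X - 2 * psum p j p = X - psum p j p by ring.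
rewrite /X /psum -sumrB; apply: pdvd_sum_coprime => i /andP[i0 _] ci.
have iu := pint_invn ci.
have iw : (p%:R + i%:R)^-1 \in pint p.
  by rewrite -natrD pint_invn // coprime_sym /coprime gcdnDl gcdnC.
rewrite pdvd_subX //.
have -> : (p%:R + i%:R)^-1 - i%:R^-1 = p%:R * - ((p%:R + i%:R)^-1 * i%:R^-1) :> rat.
  field; rewrite -natrD !pnatr_eq0 -!lt0n addn_gt0 i0 orbT //.
by rewrite pdvdMr ?pdvd_p //; pint_closed.
Qed.

(** Modulo p^2, 1/(p + i)^4 = 1/i^4 - 4p/i^5, and the linear terms sum to a multiple of p^2 by
    [psum5_pdvd]. *)
Lemma psum4_double : odd p -> psum p 4 (2 * p) - 2 * psum p 4 p \in pdvd p 2.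
Proof.
move=> p_odd; rewrite psum_double.
have P5 := psum5_pdvd 1 p_odd; rewrite mul1n in P5.
set X := \sum_(1 <= i < p | _) _.
have -> : psum p 4 p + X - 2 * psum p 4 p =
    (X - psum p 4 p + 4 * p%:R * psum p 5 p) - 4 * (p%:R * psum p 5 p) by ring.
rewrite rpredB //; last first.
  by rewrite pdvdMl ?rpred_nat // (@pdvdM p p_pr 1 1) ?pdvd_p.
rewrite /X /psum mulr_sumr -sumrB -big_split /=.
apply: pdvd_sum_coprime => i /andP[i0 _] ci.
have iu := pint_invn ci.
have iw : (p%:R + i%:R)^-1 \in pint p.
  by rewrite -natrD pint_invn // coprime_sym /coprime gcdnDl gcdnC.
have -> : (p%:R + i%:R)^-1 ^+ 4 - i%:R^-1 ^+ 4 + 4 * p%:R * i%:R^-1 ^+ 5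
  = p%:R * p%:R * (i%:R^-1 ^+ 2 * (p%:R + i%:R)^-1 ^+ 4 *
     (10 + 20 * (p%:R * i%:R^-1) + 15 * (p%:R * i%:R^-1) ^+ 2
      + 4 * (p%:R * i%:R^-1) ^+ 3)) :> rat.
  field; rewrite -natrD !pnatr_eq0 -!lt0n addn_gt0 i0 orbT //.
by rewrite pdvdMr ?(@pdvdM p p_pr 1 1) ?pdvd_p //; pint_closed.
Qed.

(** Doubling permutes the nonzero residues modulo p, with inverse multiplication by (p + 1)/2; the
    hypothesis lets F be evaluated at 2 i instead of its residue. *)
Lemma sum_scale2 s (F : nat -> rat) : odd p ->
  (forall i, (0 < i < p)%N -> F ((2 * i) %% p)%N - F (2 * i)%N \in pdvd p s) ->
  \sum_(1 <= i < p) F i - \sum_(1 <= i < p) F (2 * i)%N \in pdvd p s.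
Proof.
move=> p_odd HF; have p0 := prime_gt0 p_pr.
have mulK i : (i < p)%N -> ((((2 * i) %% p)%N * (p.+1)./2) %% p = i)%N.
  move=> ip; rewrite modnMml mulnAC [(2 * _)%N]mul2n.
  have -> : ((p.+1)./2.*2 = p + 1)%N by rewrite even_halfK /= ?p_odd // addn1.
  by rewrite mulnDl mul1n [(p * i)%N]mulnC modnMDl modn_small.
suff -> : \sum_(1 <= i < p) F i = \sum_(1 <= i < p) F ((2 * i) %% p)%N.
  by rewrite -sumrB big_nat rpred_sum.
have E G : \sum_(1 <= i < p) G i = \sum_(i < p) G i - G 0%N :> rat.
  by rewrite -(big_mkord xpredT) [in RHS]big_ltn // [RHS]addrAC subrr add0r.
rewrite !E muln0 mod0n; congr (_ - _).
pose h (i : 'I_p) : 'I_p := Ordinal (ltn_pmod (2 * i) p0).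
have hinj : injective h.
  move=> i j /(congr1 val) /= ij; apply: val_inj => /=.
  by rewrite -(mulK i) // ij mulK.
by rewrite (reindex_inj hinj).
Qed.

Lemma psum_small j : psum p j p = \sum_(1 <= i < p) i%:R^-1 ^+ j.
Proof.
rewrite /psum [LHS]big_nat_cond [RHS]big_nat_cond; apply: eq_bigl => i.
by case: (boolP (0 < i < p)%N) => //= /andP[i0 ip]; rewrite coprime_small.
Qed.

Lemma inv_mod_sub i : odd p -> (0 < i < p)%N ->
  [/\ ((2 * i) %% p)%N%:R^-1 \in pint p, (2 * i)%N%:R^-1 \in pint p &
   ((2 * i) %% p)%N%:R^-1 - (2 * i)%N%:R^-1 \in pdvd p 1].
Proof.
move=> p_odd /andP[i0 ip].
have c2i : coprime (2 * i) p by rewrite coprimeMl coprime2n p_odd coprime_small.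
have cm : coprime ((2 * i) %% p) p by rewrite coprime_modl.
have pos k : coprime k p -> k%:R != 0 :> rat.
  rewrite pnatr_eq0; apply: contraTneq => ->.
  by rewrite /coprime gcd0n neq_ltn (prime_gt1 p_pr) orbT.
split; rewrite ?pint_invn //.
have E : (2 * i)%:R = (2 * i %/ p)%:R * p%:R + (2 * i %% p)%:R :> rat.
  by rewrite {1}(divn_eq (2 * i) p) natrD natrM.
have -> : ((2 * i) %% p)%N%:R^-1 - (2 * i)%N%:R^-1
   = p%:R * ((2 * i %/ p)%:R * ((2 * i) %% p)%N%:R^-1 * (2 * i)%N%:R^-1) :> rat.
  have := pos _ c2i; have := pos _ cm; rewrite E => ? ?.
  by field; apply/andP.
by rewrite pdvdMr ?pdvd_p //; pint_closed.
Qed.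

(** Doubling the indices divides the sum by 4 and preserves it modulo p, so 3/4 of it vanishes
    modulo p. *)
Lemma psum2_pdvd : (3 < p)%N -> psum p 2 p \in pdvd p 1.
Proof.
move=> p3; have p_odd : odd p by case: (even_prime p_pr) p3 => // ->.
apply: (@pdvd_cancel p p_pr 1 3); first by rewrite coprime_small.
rewrite psum_small.
have := @sum_scale2 1 (fun i => i%:R^-1 ^+ 2) p_odd.
set S := \sum_(1 <= i < p) _ => H.
have {}H : S - 4^-1 * S \in pdvd p 1.
  rewrite {2}/S mulr_sumr.
  have -> : \sum_(1 <= i < p) 4^-1 * i%:R^-1 ^+ 2
    = \sum_(1 <= i < p) (2 * i)%N%:R^-1 ^+ 2 :> rat.
    by apply: eq_bigr => i _; rewrite natrM invfM exprMn; congr (_ * _); field.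
  apply: H => i ip; have [? ? ?] := inv_mod_sub p_odd ip.
  by rewrite pdvd_subX.
have -> : 3 * S = 4 * (S - 4^-1 * S) by field.
by rewrite pdvdMl ?rpred_nat.
Qed.

(* Modulo p^2 the p-th power of i only depends on i modulo p, so replacing i by 2 i
   permutes the terms while it multiplies the sum by 16^-p, which is not 1 modulo p. *)
Lemma sum_inv4p_pdvd : (5 < p)%N ->
  \sum_(1 <= i < p) (i%:R^-1 ^+ p) ^+ 4 \in pdvd p 2.
Proof.
move=> p5; have p_odd : odd p by case: (even_prime p_pr) p5 => // ->.
have := @sum_scale2 2 (fun i => (i%:R^-1 ^+ p) ^+ 4) p_odd.
set S := \sum_(1 <= i < p) _ => H.
have E : \sum_(1 <= i < p) ((2 * i)%N%:R^-1 ^+ p) ^+ 4 = (16 ^ p)%:R^-1 * S.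
  rewrite /S mulr_sumr; apply: eq_bigr => i _.
  rewrite natrM invfM !exprMn; congr (_ * _).
  by rewrite -exprM mulnC exprM natrX -[in RHS]exprVn; congr (_ ^+ _); field.
have {}H : S - (16 ^ p)%:R^-1 * S \in pdvd p 2.
  rewrite -E; apply: H => i ip; have [? ? ?] := inv_mod_sub p_odd ip.
  by rewrite pdvd_subX ?pdvd_subXp //; pint_closed.
have p16 : (0 < 16 ^ p)%N by rewrite expn_gt0.
(* By Fermat 16^p - 1 is 15 = 3 * 5 modulo p, prime to p because p > 5. *)
apply: (@pdvd_cancel p p_pr 2 (16 ^ p - 1)).
  rewrite coprime_sym prime_coprime // -eqn_mod_dvd //.
  rewrite fermat_little // (eqn_mod_dvd p (isT : 1 <= 16)%N) (_ : 16 - 1 = 3 * 5)%N //.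
  by rewrite -prime_coprime // coprimeMr !(coprime_sym p) !coprime_small //; lia.
have -> : (16 ^ p - 1)%:R * S = (16 ^ p)%:R * (S - (16 ^ p)%:R^-1 * S).
  by rewrite natrB // mulrBr mulVKf ?mulrBl ?mul1r // pnatr_eq0 -lt0n.
by rewrite pdvdMl ?rpred_nat.
Qed.

(** In Faulhaber's formula at m = p, the term j = n gives p B_n, and every other term carries p^2
    and a p-integral Bernoulli number. *)
Lemma sum_pow_bernoulli n : (0 < n)%N -> (n.+1 < p)%N ->
  \sum_(1 <= i < p) i%:R ^+ n - p%:R * bernoulli n \in pdvd p 2.
Proof.
move=> n0 np; apply: (@pdvd_cancel p p_pr 2 n.+1); first by rewrite coprime_small.
have -> : \sum_(1 <= i < p) i%:R ^+ n = \sum_(i < p) i%:R ^+ n :> rat.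
  rewrite -(big_mkord xpredT (fun i => i%:R ^+ n)) [RHS]big_ltn ?prime_gt0 //.
  by rewrite expr0n eqn0Ngt n0 add0r.
rewrite mulrBr faulhaber big_ord_recr /= binSn subSnn expr1.
have -> : n.+1%:R * bernoulli n * p%:R = n.+1%:R * (p%:R * bernoulli n) by ring.
rewrite addrK rpred_sum // => j _.
have -> : (n.+1 - j = 2 + (n - 1 - j))%N by have := ltn_ord j; lia.
rewrite exprD -[p%:R ^+ 2]natrX pdvdMl ?rpredM ?rpred_nat //.
  by rewrite bernoulli_pint //; have := ltn_ord j; lia.
by rewrite pdvdMr ?pdvd_pX //; pint_closed.
Qed.

Lemma fermat_pdvd i : (0 < i < p)%N -> i%:R ^+ p.-1 - 1 \in pdvd p 1.
Proof.
case/andP=> i0 ip; have ci := coprime_small p_pr i0 ip.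
apply: (@pdvd_cancel p p_pr 1 i) => //.
rewrite mulrBr mulr1 -exprS prednK ?prime_gt0 // -natrX -natrB; last first.
  by rewrite -{1}[i]expn1 leq_pexp2l // prime_gt0.
have : (p %| i ^ p - i)%N.
  rewrite -eqn_mod_dvd ?fermat_little //.
  by rewrite -{1}[i]expn1 leq_pexp2l // prime_gt0.
by case/dvdnP=> k ->; rewrite natrM pdvdMl ?rpred_nat ?pdvd_p.
Qed.

(* With x = i^(p-1), the polynomial 4 x^5 - 5 x^4 + 1 is divisible by (x - 1)^2, so
   5/i^4 = 4 i^(p-5) + 1/i^(4p) modulo p^2: a weak form of Kummer's congruence. *)
Lemma psum4_bernoulli : (5 < p)%N ->
  5 * psum p 4 p - 4 * p%:R * bernoulli (p - 5) \in pdvd p 2.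
Proof.
move=> p5; rewrite psum_small.
set S := \sum_(1 <= i < p) _.
pose T := \sum_(1 <= i < p) i%:R ^+ (p - 5) : rat.
pose V := \sum_(1 <= i < p) (i%:R^-1 ^+ p) ^+ 4 : rat.
have -> : 5 * S - 4 * p%:R * bernoulli (p - 5) =
  (5 * S - 4 * T - V) + 4 * (T - p%:R * bernoulli (p - 5)) + V by ring.
rewrite rpredD ?sum_inv4p_pdvd // rpredD //; last first.
  by rewrite pdvdMl ?rpred_nat // sum_pow_bernoulli //; lia.
rewrite /S /T /V !mulr_sumr -!sumrB big_nat rpred_sum // => i ip.
have /andP[i0 ip'] := ip; have iu := pint_invn (coprime_small p_pr i0 ip').
have Hx := fermat_pdvd ip.
have i0' : i%:R != 0 :> rat by rewrite pnatr_eq0 -lt0n.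
have xE : i%:R ^+ p.-1 = i%:R ^+ (p - 5) * i%:R ^+ 4 :> rat.
  by rewrite -exprD; congr (_ ^+ _); lia.
have vE : i%:R^-1 ^+ p = i%:R^-1 * (i%:R ^+ p.-1)^-1 :> rat.
  by rewrite -[in LHS](prednK (prime_gt0 p_pr)) exprS exprVn.
set x := i%:R ^+ p.-1 in xE vE Hx.
have x0 : x != 0 by rewrite expf_neq0.
have ix : x^-1 \in pint p by rewrite /x -exprVn; pint_closed.
have ix' : x \in pint p by rewrite /x; pint_closed.
have -> : i%:R ^+ (p - 5) = x * i%:R^-1 ^+ 4 :> rat by rewrite xE; field.
rewrite vE.
have -> : 5 * i%:R^-1 ^+ 4 - 4 * (x * i%:R^-1 ^+ 4) - (i%:R^-1 * x^-1) ^+ 4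
  = (x - 1) * (x - 1) * - (i%:R^-1 ^+ 4 * x^-1 ^+ 4 *
     (4 * x ^+ 3 + 3 * x ^+ 2 + 2 * x + 1)) by field; rewrite x0 i0'.
by rewrite pdvdMr ?(@pdvdM p p_pr 1 1) //; pint_closed.
Qed.

End PowerSums.

(** * Elimination of the signs *)

Definition inv_poly (p n : nat) : {poly rat} :=
  \poly_(i < n) (if coprime i p then i%:R^-1 else 0).

(* The unsigned sum of 1/(i_1 ... i_5) over the 5-tuples of entries coprime to p and
   of sum N, read off as the coefficient of x^N in (\sum_(p does not divide i) x^i/i)^5. *)
Definition Zsum (p N : nat) : rat := (inv_poly p N.+1 ^+ 5)`_N.

Lemma coef_prod_poly (R : comNzRingType) m n N (F : 'I_m -> nat -> R) :
  (\prod_k \poly_(i < n) F k i)`_N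
    = \sum_(f : {ffun 'I_m -> 'I_n} | (\sum_k (f k : nat) == N)%N)
        \prod_k F k (f k).
Proof.
under eq_bigr => k _ do rewrite poly_def.
rewrite bigA_distr_bigA coef_sum [RHS]big_mkcond /=; apply: eq_bigr => f _.
rewrite scaler_prod -expr_sum coefZ coefXn eq_sym.
by case: eqP => _; rewrite ?mulr1 ?mulr0.
Qed.

Lemma coef_expr_trunc (R : comNzRingType) (P Q : {poly R}) N k i :
  (forall j, (j <= N)%N -> P`_j = Q`_j) -> (i <= N)%N ->
  (P ^+ k)`_i = (Q ^+ k)`_i.
Proof.
move=> PQ; elim: k i => [|k IH] i iN //; rewrite !exprS !coefM.
apply: eq_bigr => j _; rewrite PQ ?IH //; have := ltn_ord j; lia.
Qed.

Lemma coef_comp_polyN (R : comNzRingType) (P : {poly R}) i :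
  (P \Po (- 'X))`_i = (-1) ^+ i * P`_i.
Proof.
rewrite comp_polyE -[in RHS](coefK P) coef_poly.
rewrite (eq_bigr (fun j : 'I_(size P) => ((-1) ^+ j * P`_j) *: 'X^j)).
  by rewrite -(poly_def _ (fun j => (-1) ^+ j * P`_j)) coef_poly; case: ifP; rewrite ?mulr0.
by move=> j _; rewrite -[- 'X]scaleN1r exprZn scalerA mulrC.
Qed.

Section Signs.

Variable p : nat.
Hypothesis p_pr : prime p.

Lemma coprime_posE i : coprime_pos p i = coprime i p.
Proof.
rewrite /coprime_pos; case: i => //=.
by rewrite /coprime gcd0n; apply/esym/negbTE; rewrite neq_ltn prime_gt1 ?orbT.
Qed.

Lemma sum5_coef N (s : 'I_5 -> nat -> rat) :
  sum5 p (fun i : {ffun 'I_5 -> 'I_N.+1} => \prod_k s k (i k))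
    = (\prod_k \poly_(i < N.+1) (if coprime i p then s k i / i%:R else 0))`_N.
Proof.
rewrite coef_prod_poly /sum5 big_mkcondl /=; apply: eq_bigr => f _.
case: ifP => [/forallP Hf|/negbT].
  rewrite -prodf_div; apply: eq_bigr => k _.
  by have := Hf k; rewrite coprime_posE => ->.
rewrite negb_forall => /existsP[k]; rewrite coprime_posE => /negbTE Hk.
by rewrite (bigD1 k) //= Hk mul0r.
Qed.

Lemma inv_polyN n : \poly_(i < n) (if coprime i p then (-1) ^+ i / i%:R else 0)
  = inv_poly p n \Po (- 'X).
Proof.
apply/polyP=> i; rewrite coef_comp_polyN !coef_poly.
by case: (i < n)%N; case: (coprime i p); rewrite ?mulr0.
Qed.

Lemma inv_poly1 n : \poly_(i < n) (if coprime i p then 1 / i%:R else 0) = inv_poly p n.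
Proof. by apply: eq_poly => i _; rewrite div1r. Qed.

Lemma sum5_sign1 N :
  sum5 p (fun i : {ffun 'I_5 -> 'I_N.+1} => (-1) ^+ (i 0%R : nat))
    = ((inv_poly p N.+1 \Po (- 'X)) * inv_poly p N.+1 ^+ 4)`_N.
Proof.
pose s (k : 'I_5) (i : nat) : rat := if k == 0 then (-1) ^+ i else 1.
transitivity (sum5 p (fun i : {ffun 'I_5 -> 'I_N.+1} => \prod_k s k (i k))).
  rewrite /sum5; apply: eq_bigr => f _; congr (_ / _).
  by rewrite !big_ord_recl big_ord0 /s /= !mulr1.
rewrite sum5_coef !big_ord_recl big_ord0 /s /= mulr1 inv_polyN inv_poly1.
by rewrite !exprS expr0 mulr1.
Qed.

Lemma sum5_sign2 N :
  sum5 p (fun i : {ffun 'I_5 -> 'I_N.+1} => (-1) ^+ (i 0%R + i 1%R)%N)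
    = ((inv_poly p N.+1 \Po (- 'X)) ^+ 2 * inv_poly p N.+1 ^+ 3)`_N.
Proof.
pose s (k : 'I_5) (i : nat) : rat := if (k < 2)%N then (-1) ^+ i else 1.
transitivity (sum5 p (fun i : {ffun 'I_5 -> 'I_N.+1} => \prod_k s k (i k))).
  rewrite /sum5; apply: eq_bigr => f _; congr (_ / _).
  rewrite !big_ord_recl big_ord0 /s /= !mulr1 exprD; congr (_ * _ ^+ _).
  by congr (nat_of_ord (f _)); apply: val_inj.
rewrite sum5_coef !big_ord_recl big_ord0 /s /= mulr1 inv_polyN inv_poly1.
by rewrite mulrA -expr2 ![_ ^+ 3]exprS expr2.
Qed.

(** Odd exponents cancel and 2/(2j) = 1/j; since p is odd, 2j and j are coprime to p
    simultaneously. *)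
Lemma inv_poly_even q : odd p ->
  inv_poly p (2 * q).+1 + (inv_poly p (2 * q).+1 \Po (- 'X))
    = inv_poly p q.+1 \Po 'X^2.
Proof.
move=> p_odd; apply/polyP=> i; rewrite coefD coef_comp_polyN coef_comp_poly_Xn //.
rewrite !coef_poly; case: (boolP (2 %| i)%N) => [/dvdnP[j ->]|i_odd].
  rewrite mulnK // [(j * 2)%N]mulnC !ltnS leq_mul2l /= coprimeMl coprime2n p_odd /=.
  rewrite exprM sqrrN !expr1n mul1r; case: (j <= q)%N; case: (coprime j p); rewrite ?addr0 //.
  (* At j = 0 everything vanishes through 0^-1 = 0. *)
  case: j => [|j]; first by rewrite muln0 invr0 addr0.
  have half2 : 2^-1 + 2^-1 = 1 :> rat by field.
  by rewrite natrM invfM -mulrDl half2 mul1r.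
have -> : (-1) ^+ i = -1 :> rat.
  by rewrite -signr_odd; move: i_odd; rewrite dvdn2 negbK => ->.
by rewrite mulN1r subrr.
Qed.

(* For even N the product of the signs eps_k = (-1)^(i_k) is 1, so
   \prod_k (1 + eps_k) = 2 (1 + e_1 + e_2) selects the tuples with all entries even. *)
Lemma sum5_signs q : odd p ->
  5 * (sum5 p (fun i : {ffun 'I_5 -> 'I_(2 * q).+1} => (-1) ^+ (i 0%R : nat))
     + 2 * sum5 p (fun i : {ffun 'I_5 -> 'I_(2 * q).+1} => (-1) ^+ (i 0%R + i 1%R)%N))
  = Zsum p q / 2 - Zsum p (2 * q).
Proof.
move=> p_odd; rewrite sum5_sign1 sum5_sign2.
have := congr1 (fun P : {poly rat} => (P ^+ 5)`_(2 * q)) (inv_poly_even q p_odd).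
rewrite -rmorphXn /= coef_comp_poly_Xn // dvdn_mulr // mulKn // -/(Zsum p q).
rewrite /Zsum; set f := inv_poly p (2 * q).+1; set g := f \Po _.
have gg : g \Po (- 'X) = f.
  by rewrite /g -comp_polyA rmorphN /= comp_polyX opprK comp_polyXr.
(* Replacing x by -x preserves coefficients of even exponent, so f and g = f(-x) may be
   exchanged. *)
have flip P : (P \Po (- 'X))`_(2 * q) = P`_(2 * q) :> rat.
  by rewrite coef_comp_polyN exprM sqrrN !expr1n mul1r.
have f5 : (g ^+ 5)`_(2 * q) = (f ^+ 5)`_(2 * q).
  by rewrite -flip rmorphXn /= gg.
have f4 : (f * g ^+ 4)`_(2 * q) = (g * f ^+ 4)`_(2 * q).
  by rewrite -flip rmorphM rmorphXn /= gg.
have f3 : (f ^+ 2 * g ^+ 3)`_(2 * q) = (g ^+ 2 * f ^+ 3)`_(2 * q).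
  by rewrite -flip rmorphM !rmorphXn /= gg.
(* At x^(2q) this reads 2 Z(2q) + 10 s_1 + 20 s_2 = Z(q), where s_1 and s_2 are the two signed
   sums. *)
have -> : (f + g) ^+ 5 = f ^+ 5 + g ^+ 5 + 5 *: (g * f ^+ 4 + f * g ^+ 4)
    + 10 *: (g ^+ 2 * f ^+ 3 + f ^+ 2 * g ^+ 3).
  by rewrite -!mul_polyC !rmorph_nat; ring.
rewrite !coefD !coefZ !coefD f5 f4 f3 => <-.
by field.
Qed.

End Signs.

(** * The case r = 1 *)

(* Elementary symmetric functions of 1, 1/2, ..., 1/m. *)
Fixpoint esym (k m : nat) : rat :=
  match k, m with
  | 0, _ => 1
  | _.+1, 0 => 0
  | k'.+1, m'.+1 => esym k m' + esym k' m' / m'.+1%:R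
  end.

(** The truncation of -log(1 - x); its constant term is 0^-1 = 0. *)
Definition full_poly (n : nat) : {poly rat} := \poly_(i < n) i%:R^-1.

Lemma esym0 m : esym 0 m = 1.
Proof. by case: m. Qed.

Lemma esymS k m : esym k.+1 m = \sum_(i < m) esym k i / i.+1%:R.
Proof.
elim: m => [|m IH]; first by rewrite big_ord0.
by rewrite big_ord_recr /= -IH.
Qed.

(** The derivative of the n-th power of -log(1 - x) is n times the (n-1)-st power over 1 - x, and
    dividing by 1 - x takes partial sums of coefficients; [esymS] is the matching recursion. *)
Lemma coef_full_poly_exp K n N : (N.+1 < K)%N ->
  (full_poly K ^+ n.+1)`_N.+1 = (n.+1)`!%:R / N.+1%:R * esym n N.
Proof.
elim: n N => [|n IH] N NK.
  by rewrite expr1 coef_poly NK esym0 div1r mulr1.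
have F0 : (full_poly K ^+ n.+1)`_0 = 0.
  by rewrite exprS coef0M coef_poly invr0; case: ifP; rewrite mul0r.
have H : N.+1%:R * (full_poly K ^+ n.+2)`_N.+1
   = n.+2%:R * \sum_(j < N.+1) (full_poly K ^+ n.+1)`_j.
  rewrite !mulr_natl -coef_deriv deriv_exp [_^`() * _]mulrC coefMn coefM; congr (_ *+ _).
  apply: eq_bigr => j _; rewrite coef_deriv coef_poly.
  have -> : ((N - j).+1 < K)%N by lia.
  by rewrite -[_^-1 *+ _]mulr_natr mulVf ?mulr1 // pnatr_eq0.
apply: (mulfI (_ : N.+1%:R != 0)); first by rewrite pnatr_eq0.
rewrite H big_ord_recl F0 add0r (esymS n) mulrA mulrCA divff ?pnatr_eq0 // mulr1.
rewrite [(n.+2)`!]factS natrM -[RHS]mulrA; congr (_ * _); rewrite mulr_sumr.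
apply: eq_bigr => j _; rewrite lift0 IH; last by have := ltn_ord j; lia.
by rewrite mulrAC -mulrA.
Qed.

Lemma coef_full_poly K n N : (0 < N)%N -> (N < K)%N ->
  (full_poly K ^+ n.+1)`_N = (n.+1)`!%:R / N%:R * esym n N.-1.
Proof. by case: N => // N _; apply: coef_full_poly_exp. Qed.

Definition hsum (j m : nat) : rat := \sum_(1 <= i < m.+1) i%:R^-1 ^+ j.

(** One more variable x changes e_k by x e_(k-1) and the power sums by x^j, so induction leaves
    polynomial identities; the factors k! avoid division. *)
Lemma newton_identities m :
  [/\ esym 1 m = hsum 1 m,
      2 * esym 2 m = hsum 1 m ^+ 2 - hsum 2 m,
      6 * esym 3 m = hsum 1 m ^+ 3 - 3 * hsum 1 m * hsum 2 m + 2 * hsum 3 m &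
      24 * esym 4 m = hsum 1 m ^+ 4 - 6 * hsum 1 m ^+ 2 * hsum 2 m
        + 8 * hsum 1 m * hsum 3 m + 3 * hsum 2 m ^+ 2 - 6 * hsum 4 m].
Proof.
elim: m => [|m [E1 E2 E3 E4]].
  by rewrite /hsum !big_geq //=; split; ring.
have S j : hsum j m.+1 = hsum j m + m.+1%:R^-1 ^+ j by rewrite /hsum big_nat_recr.
have D k : esym k.+1 m.+1 = esym k.+1 m + esym k m * m.+1%:R^-1 by [].
rewrite !S !D esym0; move: (m.+1%:R^-1) => x; split.
- by rewrite E1; ring.
- by rewrite mulrDr E2 E1; ring.
- have F : 6 * (esym 2 m * x) = 3 * (2 * esym 2 m) * x by ring.
  by rewrite mulrDr E3 F E2; ring.
- have F : 24 * (esym 3 m * x) = 4 * (6 * esym 3 m) * x by ring.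
  by rewrite mulrDr E4 F E3; ring.
Qed.

Section BaseCase.

Variable p : nat.
Hypothesis p_pr : prime p.

(** The full series adds x^p/p; in the fifth power this is always multiplied by a series without
    constant term, so it contributes only beyond degree p. *)
Lemma Zsum_p : Zsum p p = (full_poly p.+1 ^+ 5)`_p.
Proof.
have p0 := prime_gt0 p_pr.
have E : full_poly p.+1 = inv_poly p p.+1 + 'X^p * p%:R^-1%:P.
  apply/polyP=> i; rewrite coefD coefMC coefXn !coef_poly ltnS leq_eqVlt.
  have [->|ip] := eqVneq i p.
    by rewrite /= prime_coprime // dvdnn add0r mul1r.
  rewrite /= mul0r addr0; case: ifP => // ltip; case: ifP => // /negbT.
  case: i ip ltip => [|i] _ ip; first by rewrite invr0.
  by rewrite coprime_small.
rewrite E /Zsum; set f := inv_poly p p.+1; set u := _%:P.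
have f0 : f`_0 = 0 by rewrite coef_poly invr0 !if_same.
have -> : (f + 'X^p * u) ^+ 5 = f ^+ 5 + 'X^p * (f * (5 * f ^+ 3 * u
     + 10 * f ^+ 2 * 'X^p * u ^+ 2 + 10 * f * 'X^p ^+ 2 * u ^+ 3
     + 5 * 'X^p ^+ 3 * u ^+ 4)) + 'X^p * ('X^p * ('X^p ^+ 3 * u ^+ 5)) by ring.
by rewrite !coefD !coefXnM ltnn subnn p0 coef0M f0 mul0r !addr0.
Qed.

(** The full series adds x^p/p and x^(2p)/(2p) to the coprime part f. As f has no constant term,
    only a single x^p/p times f^4 reaches x^(2p); for the same reason f^4 and the full fourth power
    agree at x^p. *)
Lemma Zsum_2p : Zsum p (2 * p) =
  (full_poly (2 * p).+1 ^+ 5)`_(2 * p) - 5 / p%:R * (full_poly (2 * p).+1 ^+ 4)`_p.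
Proof.
have p0 := prime_gt0 p_pr; have p0f : (0 == p)%N = false by lia.
have npp : coprime p p = false by rewrite prime_coprime // dvdnn.
pose u : {poly rat} := p%:R^-1%:P + 'X^p * (2 * p)%:R^-1%:P.
have E : full_poly (2 * p).+1 = inv_poly p (2 * p).+1 + 'X^p * u.
  apply/polyP=> i; rewrite coefD coefXnM !coef_poly.
  rewrite /u coefD coefMC coefXn coefC ltnS.
  case: (ltnP i p) => [ip|pi].
    rewrite addr0; case: ifP => // _; case: ifP => // /negbT.
    by case: i ip => [|i] ip; rewrite ?invr0 // coprime_small.
  have [->|ip] := eqVneq i p.
    by rewrite subnn eqxx p0f npp if_same add0r mul0r addr0 leq_pmull.
  have -> : (i - p == 0)%N = false by lia.
  rewrite add0r; have [->|ip2] := eqVneq i (2 * p)%N.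
    rewrite leqnn (_ : 2 * p - p = p)%N; last by lia.
    by rewrite eqxx mul1r coprimeMl npp andbF add0r.
  have -> : (i - p == p)%N = false by lia.
  rewrite mul0r addr0; case: ifP => // i2p; case: ifP => // /negbT.
  rewrite coprime_sym prime_coprime // negbK => /dvdnP[[|[|[|k]]] ki].
  - by rewrite ki mul0n invr0.
  - by rewrite ki mul1n eqxx in ip.
  - by rewrite ki eqxx in ip2.
  - have : (3 * p <= i)%N by rewrite ki leq_mul2r orbT.
    by move=> ?; exfalso; move: i2p p0; lia.
rewrite E /Zsum; set f := inv_poly p (2 * p).+1.
have f0 : f`_0 = 0 by rewrite coef_poly invr0 !if_same.
have -> : (f + 'X^p * u) ^+ 4 = f ^+ 4 + 'X^p * (f * (4 * f ^+ 2 * u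
     + 6 * f * 'X^p * u ^+ 2 + 4 * 'X^p ^+ 2 * u ^+ 3))
     + 'X^p * ('X^p * ('X^p ^+ 2 * u ^+ 4)) by ring.
have key (Y a b : {poly rat}) : (f + Y * (a + Y * b)) ^+ 5 =
    f ^+ 5 + Y * (f ^+ 4 * a *+ 5)
     + Y * (Y * (f * (5 * f ^+ 3 * b + 10 * f ^+ 2 * (a + Y * b) ^+ 2
       + 10 * f * Y * (a + Y * b) ^+ 3 + 5 * Y ^+ 2 * (a + Y * b) ^+ 4)))
     + Y * (Y * (Y * (Y ^+ 2 * (a + Y * b) ^+ 5))) by ring.
rewrite [in X in X - _]/u key -/u.
have le2p : (2 * p < p)%N = false by lia.
have subp : (2 * p - p = p)%N by lia.
rewrite !(coefD, coefXnM) le2p subp ltnn subnn p0.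
by rewrite !coefMC !coef0M f0 !mul0r !addr0; ring.
Qed.

Lemma hsum_p j : hsum j p.-1 = psum p j p.
Proof. by rewrite /hsum prednK ?prime_gt0 // psum_small. Qed.

Lemma hsum_2p j : hsum j (2 * p).-1 = psum p j (2 * p) + p%:R^-1 ^+ j.
Proof.
have p0 := prime_gt0 p_pr.
rewrite /hsum prednK ?muln_gt0 // psum_double // (@big_cat_nat _ _ _ p) //=; last by lia.
rewrite psum_small // -addrA; congr (_ + _); rewrite big_ltn; last by lia.
rewrite addrC; congr (_ + _); rewrite -[p.+1]addn1 addnC big_addn.
have -> : (2 * p - p = p)%N by lia.
rewrite [LHS]big_nat_cond [RHS]big_nat_cond; apply: eq_big => i.
  by case: (boolP (0 < i < p)%N) => //= /andP[i0 ip]; rewrite coprime_small.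
by rewrite natrD addrC.
Qed.

Hypothesis p_gt5 : (5 < p)%N.

Let p_odd : odd p.
Proof. by case: (even_prime p_pr) p_gt5 => // ->. Qed.

(** Z(p) = 120 e_4/p, and in Newton's identity all terms but -6 P_4 vanish modulo p^2, P_j being the
    power sums; [psum4_bernoulli] then gives -30 P_4/p = -24 B_(p-5). *)
Lemma Zsum_p_mod : Zsum p p + 24 * bernoulli (p - 5) \in pdvd p 1.
Proof.
have p0 := prime_gt0 p_pr; have p0' : p%:R != 0 :> rat by rewrite pnatr_eq0 -lt0n.
have [_ _ _ E4] := newton_identities p.-1.
rewrite !hsum_p in E4.
have Z : Zsum p p = 5 * (24 * esym 4 p.-1) / p%:R.
  rewrite Zsum_p coef_full_poly //.
  by rewrite (_ : 5`! = 120)%N //; field.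
have P2 : psum p 2 p \in pdvd p 1 by apply: psum2_pdvd => //; lia.
have P1 : psum p 1 p \in pdvd p 2.
  by have := @psum1_pdvd p p_pr 1 p_odd; rewrite mul1n; apply.
have P4 := psum4_bernoulli p_pr p_gt5.
have P3 : psum p 3 p \in pint p := psum_pint _ _ _.
have P1' := pdvd_pint p_pr P1; have P2' := pdvd_pint p_pr P2.
have -> : Zsum p p + 24 * bernoulli (p - 5) =
   (psum p 1 p * (5 * psum p 1 p ^+ 3 - 30 * psum p 1 p * psum p 2 p
     + 40 * psum p 3 p) + psum p 2 p * psum p 2 p * 15
    - 6 * (5 * psum p 4 p - 4 * p%:R * bernoulli (p - 5))) / p%:R.
  by rewrite Z E4; field.
rewrite pdvd_divp.
apply: rpredB; last by apply: (pdvdMl p_pr _ P4); apply: rpred_nat.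
apply: rpredD; first by apply: (pdvdMr p_pr P1); pint_closed.
apply: (pdvdMr p_pr (pdvdM p_pr P2 P2)); exact: rpred_nat.
Qed.

(** The index i = p adds the variable 1/p, in which e_4 is linear; so p enters the denominator of
    Z(2p) only as p^2, and the numerator is needed modulo p^3. *)
Lemma Zsum_2p_mod : Zsum p (2 * p) + 72 * bernoulli (p - 5) \in pdvd p 1.
Proof.
have p0 := prime_gt0 p_pr; have p0' : p%:R != 0 :> rat by rewrite pnatr_eq0 -lt0n.
have [_ _ _ E4] := newton_identities (2 * p).-1.
have [_ _ E3 _] := newton_identities p.-1.
rewrite !hsum_p in E3; rewrite !hsum_2p in E4.
have Z : Zsum p (2 * p) = 5 / 2 * (24 * esym 4 (2 * p).-1) / p%:R
     - 20 * (6 * esym 3 p.-1) / p%:R / p%:R.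
  rewrite Zsum_2p !coef_full_poly ?muln_gt0 //; last by lia.
  rewrite natrM.
  by rewrite (_ : 5`! = 120)%N // (_ : 4`! = 24)%N //; field.
have P2 : psum p 2 p \in pdvd p 1 by apply: psum2_pdvd => //; lia.
have P1 : psum p 1 p \in pdvd p 2.
  by have := @psum1_pdvd p p_pr 1 p_odd; rewrite mul1n; apply.
have Q2 : psum p 2 (2 * p) \in pdvd p 1.
  rewrite -[psum p 2 (2 * p)](subrK (2 * psum p 2 p)) rpredD //.
    exact: psum_double_pdvd.
  by rewrite pdvdMl ?rpred_nat.
have Q1 : psum p 1 (2 * p) \in pdvd p 2 by apply: psum1_pdvd.
have D3 := psum3_pdvd p_pr 2 p_odd.
have D3' := psum3_pdvd p_pr 1 p_odd; rewrite mul1n in D3'.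
have D4 := psum4_double p_pr p_odd.
have DB := psum4_bernoulli p_pr p_gt5.
have Q3 : psum p 3 (2 * p) \in pint p := psum_pint _ _ _.
have P1' := pdvd_pint p_pr P1; have P2' := pdvd_pint p_pr P2.
have Q1' := pdvd_pint p_pr Q1; have Q2' := pdvd_pint p_pr Q2.
have pp := pdvd_p p_pr.
have i2 : 2^-1 \in pint p by apply: (@pint_invn p 2); rewrite coprime2n.
rewrite natrM in D3.
(* The coefficients eliminate in turn the cubes by [psum3_pdvd], the fourth powers up to 2 p by
   [psum4_double] and those up to p by [psum4_bernoulli]; each summand is divisible by p^3. *)
have -> : Zsum p (2 * p) + 72 * bernoulli (p - 5) =
   (5 * 2^-1 * (p%:R * (psum p 1 (2 * p) * (psum p 1 (2 * p) ^+ 3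
       - 6 * psum p 1 (2 * p) * psum p 2 (2 * p) + 8 * psum p 3 (2 * p))
       + psum p 2 (2 * p) * psum p 2 (2 * p) * 3))
    + 10 * (psum p 1 (2 * p) * (psum p 1 (2 * p) * psum p 1 (2 * p))
       - 3 * (psum p 1 (2 * p) * psum p 2 (2 * p)))
    - 20 * (psum p 1 p * (psum p 1 p * psum p 1 p) - 3 * (psum p 1 p * psum p 2 p))
    + 10 * (2 * psum p 3 (2 * p) + 3 * (2%:R * p%:R) * psum p 4 (2 * p))
    - 20 * (2 * psum p 3 p + 3 * p%:R * psum p 4 p)
    - 75 * (p%:R * (psum p 4 (2 * p) - 2 * psum p 4 p))
    - 18 * (p%:R * (5 * psum p 4 p - 4 * p%:R * bernoulli (p - 5)))) / p%:R / p%:R.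
  by rewrite Z E3 E4; field.
have pM2 x y : x \in pdvd p 1 -> y \in pdvd p 2 -> x * y \in pdvd p 3.
  exact: pdvdM.
have pM2' x y : x \in pdvd p 2 -> y \in pdvd p 1 -> x * y \in pdvd p 3.
  exact: pdvdM.
have pM11 x y : x \in pdvd p 1 -> y \in pdvd p 1 -> x * y \in pdvd p 2.
  exact: pdvdM.
have pC n x : x \in pdvd p 3 -> n%:R * x \in pdvd p 3.
  by move=> px; rewrite pdvdMl // rpred_nat.
have p11 x : x \in pdvd p 2 -> x \in pdvd p 1 by apply: pdvdW.
have pB x y : x \in pdvd p 3 -> y \in pdvd p 3 -> x - y \in pdvd p 3.
  exact: rpredB.
have C1 x y : x \in pdvd p 2 -> y \in pdvd p 1 ->
    x * (x * x) - 3 * (x * y) \in pdvd p 3.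
  move=> px py; have px' := p11 _ px.
  exact: pB (pM2' _ _ px (p11 _ (pM11 _ _ px' px'))) (pC 3%N _ (pM2' _ _ px py)).
have div2 x : x \in pdvd p 3 -> x / p%:R / p%:R \in pdvd p 1.
  by move=> px; rewrite pdvd_divp pdvd_divp.
apply: (div2 _).
apply: (pB _ _ _ (pC 18%N _ (pM2 _ _ pp DB))).
apply: (pB _ _ _ (pC 75%N _ (pM2 _ _ pp D4))).
apply: (pB _ _ _ (pC 20%N _ D3')).
apply: rpredD; last exact: (pC 10%N _ D3).
apply: (pB _ _ _ (pC 20%N _ (C1 _ _ P1 P2))).
apply: rpredD; last exact: (pC 10%N _ (C1 _ _ Q1 Q2)).
apply: (pdvdMl p_pr); first by pint_closed.
apply: (pM2 _ _ pp); apply: rpredD.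
  by apply: (pdvdMr p_pr Q1); pint_closed.
apply: (pdvdMr p_pr (pM11 _ _ Q2 Q2)); exact: rpred_nat.
Qed.

End BaseCase.

(** * From p^r to p^(r+1) *)

Lemma sum_ord_widen (R : nmodType) m n (F : nat -> R) : (m <= n)%N ->
  (forall i, (m <= i)%N -> (i < n)%N -> F i = 0) ->
  \sum_(i < m) F i = \sum_(i < n) F i.
Proof.
move=> mn F0; rewrite (big_ord_widen n F mn) big_mkcond /=.
by apply: eq_bigr => i _; case: ltnP => // mi; rewrite F0.
Qed.

Lemma coef_mul_comp_Xn (R : comNzRingType) (A B : {poly R}) q n : (0 < q)%N ->
  (A * (B \Po 'X^q))`_(n * q) = \sum_(c < n.+1) A`_(c * q) * B`_(n - c).
Proof.
move=> q0; rewrite comp_polyE mulr_sumr coef_sum.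
pose G t := if (t <= n)%N then A`_((n - t) * q) * B`_t else 0.
transitivity (\sum_(t < size B) G t).
  apply: eq_bigr => t _; rewrite -scalerAr coefZ -exprM coefMXn /G mulrC.
  rewrite [(q * t)%N]mulnC ltn_pmul2r // ltnNge mulnBl.
  by case: leqP => //= _; rewrite mul0r.
pose M := maxn (size B) n.+1.
rewrite (@sum_ord_widen _ _ M) ?leq_maxl //; last first.
  by move=> i Bi _; rewrite /G [B`_i]nth_default // mulr0 if_same.
rewrite -(@sum_ord_widen _ n.+1 M G) ?leq_maxr //; last first.
  by move=> i ni _; rewrite /G leqNgt ni.
rewrite (reindex_inj rev_ord_inj) /=; apply: eq_bigr => c _.
by rewrite /G subSS leq_subr subKn // -ltnS.
Qed.

Lemma coef_mul_comp_Xn_small (R : comNzRingType) (A B : {poly R}) q i :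
  (0 < q)%N -> (size A <= q)%N ->
  (A * (B \Po 'X^q))`_i = A`_(i %% q) * B`_(i %/ q).
Proof.
move=> q0 sA; rewrite coefM.
have imi : (i %% q < i.+1)%N by rewrite ltnS leq_mod.
rewrite (bigD1 (Ordinal imi)) //= coef_comp_poly_Xn //.
have E : (i - i %% q = i %/ q * q)%N by rewrite {1}(divn_eq i q) addnK.
rewrite E dvdn_mull // mulnK // big1 ?addr0 // => j ji.
have [qj|jq] := leqP q j; first by rewrite nth_default ?mul0r // (leq_trans sA).
rewrite coef_comp_poly_Xn //; case: ifP; rewrite ?mulr0 // => dq.
case/negP: ji; apply/eqP/val_inj => /=.
have ji : (j <= i)%N by rewrite -ltnS.
by rewrite -[LHS](modn_small jq); apply/eqP; rewrite eq_sym eqn_mod_dvd.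
Qed.

Lemma coef_natM (R : comNzRingType) n (P : {poly R}) i :
  (n%:R * P)`_i = n%:R * P`_i.
Proof. by rewrite !mulr_natl coefMn. Qed.

Definition geom_poly L : {poly rat} := \poly_(i < L) 1.

Lemma hockey_stick t k : (\sum_(j < t.+1) 'C(j + k, k) = 'C(t + k.+1, k.+1))%N.
Proof.
elim: t => [|t IH]; first by rewrite big_ord1 !add0n !binn.
by rewrite big_ord_recr /= IH (addSnnS t k) [in RHS]addSn binS.
Qed.

Lemma coef_geom_exp L k t : (t < L)%N -> (geom_poly L ^+ k.+1)`_t = 'C(t + k, k)%:R.
Proof.
elim: k t => [|k IH] t tL; first by rewrite expr1 coef_poly tL addn0 bin0.
rewrite exprSr coefM -hockey_stick natr_sum; apply: eq_bigr => j _.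
rewrite IH; last by have := ltn_ord j; lia.
rewrite coef_poly (_ : t - j < L)%N ?mulr1 //; lia.
Qed.

Lemma bin4 N : 24 * 'C(N, 4)%:R = N%:R * (N%:R - 1) * (N%:R - 2) * (N%:R - 3) :> rat.
Proof.
have [N4|] := leqP 4 N; last by case: N => [|[|[|[|]]]] // _; rewrite bin_small //; ring.
rewrite (_ : 24 = 4`!%:R) // -natrM mulnC bin_ffact !ffactnSr ffactn0 mul1n.
by rewrite subn0 !natrM !natrB //; lia.
Qed.

(** Reflecting every entry, i -> n - i, turns tuples of sum N into tuples of sum 5 n - N. *)
Lemma coef_exp_rev (R : comNzRingType) n N (F : nat -> R) : (N <= 5 * n)%N ->
  ((\poly_(i < n.+1) F i) ^+ 5)`_N
    = ((\poly_(i < n.+1) F (n - i)%N) ^+ 5)`_(5 * n - N).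
Proof.
move=> N5.
have E (P : {poly R}) : P ^+ 5 = \prod_(k < 5) P by rewrite prodr_const card_ord.
rewrite !E !coef_prod_poly.
pose h (f : {ffun 'I_5 -> 'I_n.+1}) : {ffun 'I_5 -> 'I_n.+1} := [ffun k => rev_ord (f k)].
have hK : involutive h by move=> f; apply/ffunP=> k; rewrite !ffunE rev_ordK.
rewrite (reindex_inj (can_inj hK)) /=; apply: eq_big => f.
  have -> : (\sum_k h f k = 5 * n - \sum_k f k)%N.
    have -> : (5 * n = \sum_(k < 5) n)%N by rewrite sum_nat_const card_ord.
    rewrite -sumnB; last by move=> k _; rewrite -ltnS.
    by apply: eq_bigr => k _; rewrite ffunE /= subSS.
  have : (\sum_k f k <= 5 * n)%N.
    have -> : (5 * n = \sum_(k < 5) n)%N by rewrite sum_nat_const card_ord.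
    by apply: leq_sum => k _; rewrite -ltnS.
  by move: (\sum_k f k)%N => m mn; apply/eqP/eqP; lia.
by move=> _; apply: eq_bigr => k _; rewrite ffunE /= subSS.
Qed.

Section Reduction.

Variables (p r : nat).
Hypothesis p_pr : prime p.
Hypothesis p_gt5 : (5 < p)%N.
Hypothesis r_gt0 : (0 < r)%N.

Let q := (p ^ r)%N.

Let q_gt0 : (0 < q)%N.
Proof. by rewrite expn_gt0 prime_gt0. Qed.

Let p_dvd_q : (p %| q)%N.
Proof. exact: dvdn_exp. Qed.

(** The sum S_c of 1/(a_1 ... a_5) over residues 0 < a_k < q prime to p with sum c q. *)
Definition block_sum c := (inv_poly p q ^+ 5)`_(c * q).

Lemma coprime_modq i : coprime (i %% q) p = coprime i p.
Proof.
rewrite !(coprime_sym _ p) !prime_coprime //; congr (~~ _).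
by rewrite {2}(divn_eq i q) dvdn_addr // dvdn_mull.
Qed.

Lemma coprime_gt0 i : coprime i p -> (0 < i)%N.
Proof.
by case: i => //; rewrite /coprime gcd0n => /eqP p1; have := prime_gt1 p_pr; rewrite p1.
Qed.

Definition sqinv_poly : {poly rat} :=
  \poly_(a < q) (if coprime a p then a%:R^-1 ^+ 2 else 0).

Definition rest_poly L : {poly rat} :=
  \poly_(i < L * q) (if coprime i p then
    (i %/ q)%:R ^+ 2 * (i %% q)%:R^-1 ^+ 2 * i%:R^-1 else 0).

(* The identity 1/(a + q b) = 1/a - q b/a^2 + q^2 b^2/(a^2 (a + q b)), summed over
   the residues a and quotients b of the exponents modulo q. *)
Lemma inv_poly_expand L :
  inv_poly p (L * q) = inv_poly p q * (geom_poly L \Po 'X^q)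
    + q%:R * (- (sqinv_poly * (('X * (geom_poly L)^`()) \Po 'X^q))
       + q%:R * rest_poly L).
Proof.
apply/polyP=> i; rewrite !(coefD, coefN, coef_natM).
rewrite !coef_mul_comp_Xn_small ?size_poly //.
rewrite coefXM coef_deriv !coef_poly ltn_mod q_gt0 coprime_modq ltn_divLR //.
case: (boolP (coprime i p)) => ci; last by rewrite !(if_same, mul0r, oppr0, mulr0, addr0).
have im0 : (0 < i %% q)%N by rewrite coprime_gt0 // coprime_modq.
have i0 := coprime_gt0 ci.
have E : i%:R = (i %/ q)%:R * q%:R + (i %% q)%:R :> rat.
  by rewrite {1}(divn_eq i q) natrD natrM.
have i0' : (i %/ q)%:R * q%:R + (i %% q)%:R != 0 :> rat by rewrite -E pnatr_eq0 -lt0n.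
have im0' : (i %% q)%:R != 0 :> rat by rewrite pnatr_eq0 -lt0n.
case: (ltnP i (L * q)) => iL; last first.
  rewrite mulr0 (_ : (if _ then _ else _) = 0) ?(mulr0, oppr0, addr0) //.
  case: eqP => // /eqP d0; rewrite prednK ?lt0n // ltn_divLR // ltnNge iL.
  by rewrite mul0rn.
have -> : (if (i %/ q == 0)%N then 0 else
   (if ((i %/ q).-1.+1 < L)%N then 1 else 0) *+ (i %/ q).-1.+1) = (i %/ q)%:R :> rat.
  case: eqP => [->//|/eqP d0].
  by rewrite prednK ?lt0n // ltn_divLR // iL.
rewrite E; move: (i %/ q)%:R (i %% q)%:R (q%:R) i0' im0' => b a x ab a0.
by field; rewrite ab a0.
Qed.

Lemma inv_poly_over n : inv_poly p n \is a polyOver (pint p).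
Proof.
apply: polyOver_poly => i _; case: ifP => ci; last exact: rpred0.
exact: pint_invn.
Qed.

Lemma sqinv_poly_over : sqinv_poly \is a polyOver (pint p).
Proof.
apply: polyOver_poly => i _; case: ifP => ci; last exact: rpred0.
by rewrite rpredX // pint_invn.
Qed.

Lemma geom_poly_over L : geom_poly L \is a polyOver (pint p).
Proof. by apply: polyOver_poly => i _; apply: rpred1. Qed.

Lemma rest_poly_over L : rest_poly L \is a polyOver (pint p).
Proof.
apply: polyOver_poly => i _; case: ifP => ci; last exact: rpred0.
have ci' : coprime (i %% q) p by rewrite coprime_modq.
by pint_closed.
Qed.

(** The first-order part: one of the five reciprocals is squared. *)
Definition sq_block_sum c := (inv_poly p q ^+ 4 * sqinv_poly)`_(c * q).

(** Fifth power of [inv_poly_expand]: the binomials are the coefficients of (1 - x)^-5, the factor n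
    - c comes from x times its derivative, and all other terms carry q^2. *)
Lemma Zsum_expand n :
  Zsum p (n * q) - \sum_(c < n.+1) block_sum c * 'C(n - c + 4, 4)%:R
  + q%:R * \sum_(c < n.+1) sq_block_sum c * ((n - c)%:R * 'C(n - c + 4, 4)%:R)
   \in pdvd p (r + r).
Proof.
pose L := n.+1.
(* Truncating at (n+1) q instead of n q + 1 keeps this coefficient and makes the exponents fill
   whole blocks of length q. *)
have -> : Zsum p (n * q) = (inv_poly p (L * q) ^+ 5)`_(n * q).
  apply: (@coef_expr_trunc _ _ _ (n * q)) => // j jn; rewrite !coef_poly ltnS jn.
  have -> // : (j < L * q)%N.
  by rewrite (leq_ltn_trans jn) // ltn_pmul2r.
rewrite inv_poly_expand.
set A := inv_poly p q; set T := geom_poly L; set B := sqinv_poly.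
set W := rest_poly L; set T' := T \Po 'X^q; set D := ('X * _) \Po 'X^q.
have key (U V Q : {poly rat}) : (U + Q * (- V + Q * W)) ^+ 5 = U ^+ 5
   - Q * (U ^+ 4 * V *+ 5) + Q * Q * (5 * U ^+ 4 * W + 10 * U ^+ 3 * (- V + Q * W) ^+ 2
     + 10 * Q * U ^+ 2 * (- V + Q * W) ^+ 3
     + 5 * Q ^+ 2 * U * (- V + Q * W) ^+ 4 + Q ^+ 3 * (- V + Q * W) ^+ 5) by ring.
rewrite key; set R := (X in _ + _ * _ * X).
have Rint : R \is a polyOver (pint p).
  have HA : A \is a polyOver (pint p) := inv_poly_over q.
  have HB : B \is a polyOver (pint p) := sqinv_poly_over.
  have HW : W \is a polyOver (pint p) := rest_poly_over L.
  have HX : 'X \is a polyOver (pint p) := polyOverX _.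
  have HXq : 'X^q \is a polyOver (pint p) := polyOverXn _ _.
  have HT := geom_poly_over L.
  have HT' : T' \is a polyOver (pint p) by apply: polyOver_comp.
  have HD : D \is a polyOver (pint p).
    by apply: polyOver_comp => //; apply: rpredM => //; apply: polyOver_deriv.
  by rewrite /R; pint_closed.
have -> : (A * T') ^+ 5 = A ^+ 5 * (T ^+ 5 \Po 'X^q).
  by rewrite exprMn rmorphXn.
have -> : (A * T') ^+ 4 * (B * D) *+ 5 = A ^+ 4 * B * (('X * (T ^+ 5)^`()) \Po 'X^q).
  have DE : D = ('X \Po 'X^q) * (T^`() \Po 'X^q) by rewrite /D rmorphM.
  have -> : ('X * (T ^+ 5)^`()) \Po 'X^q
      = ('X \Po 'X^q) * ((T^`() \Po 'X^q) * T' ^+ 4 *+ 5).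
    by rewrite deriv_exp rmorphM rmorphMn rmorphM rmorphXn.
  by rewrite DE; ring.
rewrite -[q%:R * q%:R * R]mulrA coefD coefB !coef_natM !coef_mul_comp_Xn //.
have -> : \sum_(c < n.+1) (A ^+ 5)`_(c * q) * (T ^+ 5)`_(n - c)
   = \sum_(c < n.+1) block_sum c * 'C(n - c + 4, 4)%:R.
  apply: eq_bigr => c _; rewrite coef_geom_exp // /L; lia.
have -> : \sum_(c < n.+1) (A ^+ 4 * B)`_(c * q) * ('X * (T ^+ 5)^`())`_(n - c)
   = \sum_(c < n.+1) sq_block_sum c * ((n - c)%:R * 'C(n - c + 4, 4)%:R).
  apply: eq_bigr => c _; congr (_ * _).
  rewrite coefXM; case: eqP => [->|/eqP nc]; first by rewrite mul0r.
  rewrite coef_deriv prednK ?lt0n // coef_geom_exp ?mulr_natl // /L; lia.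
set s1 := \sum_(c < n.+1) _; set s2 := \sum_(c < n.+1) _.
have -> : s1 - q%:R * s2 + q%:R * (q%:R * R`_(n * q)) - s1 + q%:R * s2
  = q%:R * q%:R * R`_(n * q) by ring.
apply: (pdvdMr p_pr (pdvdM p_pr (pdvd_pX p_pr r) (pdvd_pX p_pr r))).
by move/polyOverP: Rint.
Qed.

Lemma coef_polyOver P i : P \is a polyOver (pint p) -> P`_i \in pint p.
Proof. by move/polyOverP. Qed.

Lemma sq_block_sum_pint c : sq_block_sum c \in pint p.
Proof. by apply: coef_polyOver; rewrite rpredM ?rpredX ?inv_poly_over ?sqinv_poly_over. Qed.

Lemma block_sum0 : block_sum 0 = 0.
Proof. by rewrite /block_sum mul0n exprS coef0M coef_poly invr0 !if_same mul0r. Qed.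

(** Five residues below q have sum below 5 q. *)
Lemma block_sum_big c : (4 < c)%N -> block_sum c = 0.
Proof.
move=> c4; rewrite /block_sum nth_default //; apply: leq_trans (size_poly_exp_leq _ _) _.
have := size_poly q (fun i => if coprime i p then i%:R^-1 else 0 : rat).
rewrite -/(inv_poly p q) => sA.
have : (5 * q <= c * q)%N by rewrite leq_mul2r c4 orbT.
move: (size (inv_poly p q)) sA q_gt0 => sz; move: (c * q)%N q => cq Q.
by lia.
Qed.

Lemma sq_block_sum0 : sq_block_sum 0 = 0.
Proof. by rewrite /sq_block_sum mul0n exprS -mulrA coef0M coef_poly invr0 !if_same mul0r. Qed.

Lemma sq_block_sum_big c : (4 < c)%N -> sq_block_sum c = 0.
Proof.
move=> c4; rewrite /sq_block_sum nth_default //; apply: leq_trans (size_polyMleq _ _) _.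
have := size_poly q (fun i => if coprime i p then i%:R^-1 else 0 : rat).
have := size_poly q (fun i => if coprime i p then i%:R^-1 ^+ 2 else 0 : rat).
rewrite -/(inv_poly p q) -/sqinv_poly => sB sA.
have := size_poly_exp_leq (inv_poly p q) 4.
have : (5 * q <= c * q)%N by rewrite leq_mul2r c4 orbT.
move: (size (inv_poly p q ^+ 4)) (size (inv_poly p q)) (size sqinv_poly) sA sB q_gt0 => s4 sz sb.
move: (c * q)%N q => cq Q.
by lia.
Qed.

Lemma sum_block_sum n : \sum_(c < n.+1) block_sum c * 'C(n - c + 4, 4)%:R =
  block_sum 1 * 'C(n + 3, 4)%:R + block_sum 2 * 'C(n + 2, 4)%:R
    + block_sum 3 * 'C(n + 1, 4)%:R + block_sum 4 * 'C(n, 4)%:R.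
Proof.
(* Writing n + 4 - c makes the binomial vanish for n < c <= 4, so the four-term form also holds for
   small n. *)
pose G c := block_sum c * 'C(n + 4 - c, 4)%:R.
transitivity (\sum_(c < n.+1) G c).
  by apply: eq_bigr => c _; rewrite /G addnBAC // -ltnS.
rewrite (@sum_ord_widen _ _ (n + 5) G); first last.
- move=> i ni i5; rewrite /G; have [i4|i4] := ltnP 4 i; first by rewrite block_sum_big ?mul0r.
  by rewrite bin_small ?mulr0 //; lia.
- lia.
rewrite -(@sum_ord_widen _ 5 (n + 5) G); first last.
- by move=> i i5 _; rewrite /G block_sum_big ?mul0r.
- lia.
rewrite !big_ord_recr big_ord0 /= /G block_sum0 mul0r !add0r.
by rewrite -!addnBA // addn0.
Qed.

(** Under a -> q - a each reciprocal becomes -1/a modulo q, and five sign changes give a minus. *)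
Lemma block_sum_rev c : (c <= 5)%N -> block_sum c + block_sum (5 - c) \in pdvd p r.
Proof.
move=> c5.
(* The extra slot at exponent q, empty since p divides q, makes the range 0..q stable under
   reversal. *)
have Aq : inv_poly p q = inv_poly p q.+1.
  apply/polyP=> i; rewrite !coef_poly; have [->|iq] := eqVneq i q.
    by rewrite ltnn ltnSn coprime_sym prime_coprime // p_dvd_q.
  by rewrite [(i < q.+1)%N]ltnS [(i <= q)%N]leq_eqVlt (negbTE iq).
pose W : {poly rat} := \poly_(i < q.+1) (if coprime i p then i%:R^-1 * (q - i)%:R^-1 else 0).
have cq i : (i <= q)%N -> coprime (q - i) p = coprime i p.
  by move=> iq; rewrite !(coprime_sym _ p) !prime_coprime // dvdn_subr.
have Wint : W \is a polyOver (pint p).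
  apply: polyOver_poly => i iq; case: ifP => ci; last exact: rpred0.
  have ci' : coprime (q - i) p by rewrite cq.
  by pint_closed.
have E : \poly_(i < q.+1) (if coprime (q - i) p then (q - i)%:R^-1 else 0)
   = - inv_poly p q + q%:R * W.
  rewrite Aq; apply/polyP=> i; rewrite coefD coefN coef_natM !coef_poly ltnS.
  case: leqP => iq; last by rewrite oppr0 mulr0 addr0.
  rewrite cq //; case: ifP => ci; last by rewrite oppr0 mulr0 addr0.
  have i0 : i%:R != 0 :> rat by rewrite pnatr_eq0 -lt0n coprime_gt0.
  have i0' : q%:R - i%:R != 0 :> rat by rewrite -natrB // pnatr_eq0 -lt0n coprime_gt0 // cq.
  rewrite natrB //; move: (q%:R) i0' => x x0.
  by field; rewrite i0 x0.
have -> : block_sum c = ((- inv_poly p q + q%:R * W) ^+ 5)`_((5 - c) * q).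
  rewrite -E /block_sum Aq /inv_poly coef_exp_rev ?leq_mul2r ?c5 ?orbT //.
  by rewrite mulnBl.
set A := inv_poly p q.
have key (Q : {poly rat}) : (- A + Q * W) ^+ 5 = - A ^+ 5 + Q * (W * (
   5 * A ^+ 4 - 10 * A ^+ 3 * Q * W + 10 * A ^+ 2 * Q ^+ 2 * W ^+ 2
   - 5 * A * Q ^+ 3 * W ^+ 3 + Q ^+ 4 * W ^+ 4)) by ring.
rewrite key coefD coefN coef_natM; set R := W * _.
rewrite addrC addrA subrr add0r; apply: (pdvdMr p_pr); first exact: pdvd_pX.
apply: coef_polyOver; have HA : A \is a polyOver (pint p) := inv_poly_over q.
by rewrite /R; pint_closed.
Qed.

Lemma Zsum_mod_q n : Zsum p (n * q) - (block_sum 1 * 'C(n + 3, 4)%:R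
    + block_sum 2 * 'C(n + 2, 4)%:R
    + block_sum 3 * 'C(n + 1, 4)%:R + block_sum 4 * 'C(n, 4)%:R) \in pdvd p r.
Proof.
have := pdvdW p_pr (leq_addr r r) (Zsum_expand n).
rewrite sum_block_sum; set s := _ - _; set t := \sum_(c < _) _ => H.
have -> : s = s + q%:R * t - q%:R * t by ring.
apply: rpredB => //; apply: (pdvdMr p_pr (pdvd_pX p_pr r)).
apply: rpred_sum => c _; apply: rpredM; first exact: sq_block_sum_pint.
by apply: rpredM; apply: rpred_nat.
Qed.

Lemma coprime24 : coprime 24 p.
Proof.
rewrite (_ : 24 = 4 * 6)%N // coprimeMl.
by rewrite (_ : 6 = 2 * 3)%N // coprimeMl !coprime_small //; lia.
Qed.

(** For 1 <= c <= 4 the number m p is one of the four factors of 24 times the binomial. *)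
Lemma bin_pdvd m c : (0 < c <= 4)%N -> (c <= m * p)%N ->
  'C(m * p - c + 4, 4)%:R \in pdvd p 1.
Proof.
move=> c4 cm; apply: (pdvd_cancel p_pr coprime24).
rewrite bin4 natrD natrB //; move: (pdvd_mulp p_pr m) (rpred_nat (pint p) (m * p)).
move: (m * p)%:R => x x1 x0.
move: c4 {cm}; case: c => [|[|[|[|[|]]]]] // _.
- rewrite (_ : _ * _ = x * ((x + 3) * (x + 2) * (x + 1))); last by ring.
  by apply: (pdvdMr p_pr x1); pint_closed.
- rewrite (_ : _ * _ = x * ((x + 2) * (x + 1) * (x - 1))); last by ring.
  by apply: (pdvdMr p_pr x1); pint_closed.
- rewrite (_ : _ * _ = x * ((x + 1) * (x - 1) * (x - 2))); last by ring.
  by apply: (pdvdMr p_pr x1); pint_closed.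
- rewrite (_ : _ * _ = x * ((x - 1) * (x - 2) * (x - 3))); last by ring.
  by apply: (pdvdMr p_pr x1); pint_closed.
Qed.

(** The linear term of [Zsum_expand] already carries q, and [bin_pdvd] adds a factor p; r + 1 <= 2 r
    handles the remainder. *)
Lemma Zsum_mod_pq m n : n = (m * p)%N -> Zsum p (n * q) - (block_sum 1 * 'C(n + 3, 4)%:R
    + block_sum 2 * 'C(n + 2, 4)%:R
    + block_sum 3 * 'C(n + 1, 4)%:R + block_sum 4 * 'C(n, 4)%:R)
  \in pdvd p r.+1.
Proof.
move=> nE; have rr : (r.+1 <= r + r)%N by rewrite -addn1 leq_add2l.
have := pdvdW p_pr rr (Zsum_expand n).
rewrite sum_block_sum; set s := _ - _; set t := \sum_(c < _) _ => H.
have -> : s = s + q%:R * t - q%:R * t by ring.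
apply: rpredB => //; rewrite -addn1; apply: (pdvdM p_pr (pdvd_pX p_pr r)).
apply: rpred_sum => c _; have [c4|c4] := ltnP 4 c.
  by rewrite sq_block_sum_big // mul0r rpred0.
case: (posnP c) => [->|c0]; first by rewrite sq_block_sum0 mul0r rpred0.
apply: (pdvdMl p_pr (sq_block_sum_pint _)); apply: (pdvdMl p_pr (rpred_nat _ _)).
by have := @bin_pdvd m c; rewrite -nE; apply; rewrite ?c0 // -ltnS.
Qed.

(** Modulo x^2 with x = m p, 24 times the four binomials are 6x, -2x, 2x, -6x. Modulo q, S_4 = -S_1,
    S_3 = -S_2, S_1 = Z(q) and S_2 = Z(2q) - 5 Z(q), which gives the combination; the hypotheses
    make x^2 S_c vanish modulo p^(r+1). *)
Lemma Zsum_step m : Zsum p q \in pdvd p r.-1 -> Zsum p (2 * q) \in pdvd p r.-1 ->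
  6 * Zsum p (m * p * q) - (m * p)%:R * (8 * Zsum p q - Zsum p (2 * q))
    \in pdvd p r.+1.
Proof.
have c4 : coprime 4 p by apply: coprime_small => //; apply: leq_trans p_gt5.
have rE : r.+1 = (1 + 1 + r.-1)%N by case: (r) r_gt0.
have lower x : x \in pdvd p r -> x \in pdvd p r.-1 by apply: pdvdW (leq_pred r).
move=> Z1 Z2.
have e1 : Zsum p q - block_sum 1 \in pdvd p r.
  have := Zsum_mod_q 1; rewrite mul1n.
  rewrite (_ : 'C(1 + 3, 4) = 1)%N // (_ : 'C(1 + 2, 4) = 0)%N //.
  by rewrite (_ : 'C(1 + 1, 4) = 0)%N // (_ : 'C(1, 4) = 0)%N // mulr1 !mulr0 !addr0.
have e2 : Zsum p (2 * q) - (block_sum 1 * 5 + block_sum 2) \in pdvd p r.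
  have := Zsum_mod_q 2.
  rewrite (_ : 'C(2 + 3, 4) = 5)%N // (_ : 'C(2 + 2, 4) = 1)%N //.
  by rewrite (_ : 'C(2 + 1, 4) = 0)%N // (_ : 'C(2, 4) = 0)%N // mulr1 !mulr0 !addr0.
have e3 := @block_sum_rev 1 isT; have e4 := @block_sum_rev 2 isT.
rewrite (_ : 5 - 1 = 4)%N // in e3; rewrite (_ : 5 - 2 = 3)%N // in e4.
have e5 := @Zsum_mod_pq m (m * p) erefl.
have S1 : block_sum 1 \in pdvd p r.-1.
  rewrite (_ : block_sum 1 = Zsum p q - (Zsum p q - block_sum 1)); last by ring.
  exact: rpredB Z1 (lower _ e1).
have S2 : block_sum 2 \in pdvd p r.-1.
  rewrite (_ : block_sum 2 = Zsum p (2 * q) - 5 * block_sum 1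
     - (Zsum p (2 * q) - (block_sum 1 * 5 + block_sum 2))).
    apply: rpredB (lower _ e2); apply: rpredB Z2 _.
    by apply: (pdvdMl p_pr _ S1); apply: rpred_nat.
  by ring.
have S3 : block_sum 3 \in pdvd p r.-1.
  rewrite (_ : block_sum 3 = block_sum 2 + block_sum 3 - block_sum 2); last by ring.
  exact: rpredB (lower _ e4) S2.
have S4 : block_sum 4 \in pdvd p r.-1.
  rewrite (_ : block_sum 4 = block_sum 1 + block_sum 4 - block_sum 1); last by ring.
  exact: rpredB (lower _ e3) S1.
have x1 := pdvd_mulp p_pr m.
have x0 : (m * p)%:R \in pint p := rpred_nat _ _.
have B1 := bin4 (m * p + 3); have B2 := bin4 (m * p + 2).
have B3 := bin4 (m * p + 1); have B4 := bin4 (m * p).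
rewrite !natrD in B1 B2 B3.
(* The extra factor 4 turns 6 into the 24 of [bin4]. *)
apply: (@pdvd_cancel p p_pr r.+1 4 _ c4).
move: 'C(m * p + 3, 4)%:R 'C(m * p + 2, 4)%:R 'C(m * p + 1, 4)%:R 'C(m * p, 4)%:R
  B1 B2 B3 B4 e5 => C1 C2 C3 C4.
move: (m * p)%:R x1 x0 => x x1 x0 B1 B2 B3 B4 e5.
move: (Zsum p (m * p * q)) (Zsum p q) (Zsum p (2 * q)) e1 e2 e5 {Z1 Z2} => Z Zq Z2 e1 e2 e5.
set E5 := Z - _ in e5.
have -> : 4 * (6 * Z - x * (8 * Zq - Z2)) = 24 * E5
   + (block_sum 1 * (24 * C1) + block_sum 2 * (24 * C2)
      + block_sum 3 * (24 * C3) + block_sum 4 * (24 * C4))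
   - 4 * x * (8 * Zq - Z2) by rewrite /E5; ring.
rewrite B1 B2 B3 B4.
set X := _ - _.
have -> : X = 24 * E5 + x * x * (block_sum 1 * (x ^+ 2 + 6 * x + 11)
   + block_sum 2 * (x ^+ 2 + 2 * x - 1) + block_sum 3 * (x ^+ 2 - 2 * x - 1)
   + block_sum 4 * (x ^+ 2 - 6 * x + 11))
   + x * (4 * (Z2 - (block_sum 1 * 5 + block_sum 2)) + 2 * (block_sum 2 + block_sum 3)
      - 32 * (Zq - block_sum 1)
      - 6 * (block_sum 1 + block_sum 4)) by rewrite /X; ring.
have nat_pdvd n y t : y \in pdvd p t -> n%:R * y \in pdvd p t.
  by move=> py; apply: (pdvdMl p_pr _ py); apply: rpred_nat.
apply: rpredD; first apply: rpredD.
- exact: nat_pdvd e5.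
- rewrite rE; apply: (pdvdM p_pr (pdvdM p_pr x1 x1)).
  apply: rpredD; last by apply: (pdvdMr p_pr S4); pint_closed.
  apply: rpredD; last by apply: (pdvdMr p_pr S3); pint_closed.
  apply: rpredD; last by apply: (pdvdMr p_pr S2); pint_closed.
  by apply: (pdvdMr p_pr S1); pint_closed.
- apply: (pdvdM p_pr x1).
  apply: rpredB; last exact: nat_pdvd e3.
  apply: rpredB; last exact: nat_pdvd e1.
  by apply: rpredD; [exact: nat_pdvd e2 | exact: nat_pdvd e4].
Qed.

End Reduction.

(** * Induction on the exponent and conclusion *)

Lemma Zsum_lift (p k m : nat) : prime p -> (5 < p)%N ->
  Zsum p (p ^ k.+1) \in pdvd p k -> Zsum p (2 * p ^ k.+1) \in pdvd p k ->
  8 * Zsum p (p ^ k.+1) - Zsum p (2 * p ^ k.+1)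
    + 120 * ((p ^ k)%:R * bernoulli (p - 5)) \in pdvd p k.+1 ->
  Zsum p (m * p ^ k.+2) + 20 * m%:R * ((p ^ k.+1)%:R * bernoulli (p - 5))
    \in pdvd p k.+2.
Proof.
move=> p_pr p5 Z1 Z2 Z12.
have c6 : coprime 6 p.
  by rewrite (_ : 6 = 2 * 3)%N // coprimeMl !coprime_small //; apply: leq_trans p5.
have := @Zsum_step p k.+1 p_pr p5 isT m Z1 Z2.
rewrite -mulnA -expnS => H.
apply: (@pdvd_cancel p p_pr k.+2 6 _ c6).
have pk : (p ^ k.+1)%:R = p%:R * (p ^ k)%:R :> rat by rewrite expnS natrM.
rewrite pk; rewrite natrM in H.
move: H Z12 {Z1 Z2}.
move: (Zsum p (m * p ^ k.+2)) (Zsum p (p ^ k.+1)) (Zsum p (2 * p ^ k.+1)) => Z Z1 Z2 H Z12.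
(* Multiplying the third hypothesis by m p replaces 8 Z(q) - Z(2q), q = p^(k+1), by -120 p^k
   B_(p-5), and -120/6 = -20. *)
have -> : 6 * (Z + 20 * m%:R * (p%:R * (p ^ k)%:R * bernoulli (p - 5)))
   = 6 * Z - m%:R * p%:R * (8 * Z1 - Z2)
   + m%:R * (p%:R * (8 * Z1 - Z2 + 120 * ((p ^ k)%:R * bernoulli (p - 5)))) by ring.
apply: rpredD H _; apply: (pdvdMl p_pr (rpred_nat _ _)).
exact: (pdvdM p_pr (pdvd_p p_pr) Z12).
Qed.

(** The constant -120 reproduces itself: it is 8 * (-24) + 72 at the start and 8 * (-20) + 40 after
    each lift. *)
Lemma Zsum_invariant (p k : nat) : prime p -> (5 < p)%N ->
  [/\ Zsum p (p ^ k.+1) \in pdvd p k, Zsum p (2 * p ^ k.+1) \in pdvd p k &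
   8 * Zsum p (p ^ k.+1) - Zsum p (2 * p ^ k.+1)
    + 120 * ((p ^ k)%:R * bernoulli (p - 5)) \in pdvd p k.+1].
Proof.
move=> p_pr p5; have Bint : bernoulli (p - 5) \in pint p.
  by apply: (bernoulli_pint p_pr); lia.
elim: k => [|k [Z1 Z2 Z12]].
  have Z1 := Zsum_p_mod p_pr p5; have Z2 := Zsum_2p_mod p_pr p5.
  rewrite expn1 expn0 mul1r; move: Bint Z1 Z2.
  move: (bernoulli _) (Zsum p p) (Zsum p (2 * p)) => B z1 z2 Bint Z1 Z2.
  split.
  - have -> : z1 = z1 + 24 * B - 24 * B by ring.
    apply: rpredB (pdvdW p_pr (leq0n 1) Z1) _.
    by rewrite pdvd0; pint_closed.
  - have -> : z2 = z2 + 72 * B - 72 * B by ring.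
    apply: rpredB (pdvdW p_pr (leq0n 1) Z2) _.
    by rewrite pdvd0; pint_closed.
  - have -> : 8 * z1 - z2 + 120 * B = 8 * (z1 + 24 * B) - (z2 + 72 * B) by ring.
    by apply: rpredB Z2; apply: (pdvdMl p_pr _ Z1); apply: rpred_nat.
have L1 := @Zsum_lift p k 1 p_pr p5 Z1 Z2 Z12; rewrite mul1n in L1.
have L2 := @Zsum_lift p k 2 p_pr p5 Z1 Z2 Z12.
have yk : (p ^ k.+1)%:R * bernoulli (p - 5) \in pdvd p k.+1.
  exact: (pdvdMr p_pr (pdvd_pX p_pr _)).
move: L1 L2 yk {Z1 Z2 Z12}; move: ((p ^ k.+1)%:R * bernoulli _).
move: (Zsum p (p ^ k.+2)) (Zsum p (2 * p ^ k.+2)).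
move=> z1 z2 y L1 L2 yk.
have nat_pdvd n : n%:R * y \in pdvd p k.+1.
  by apply: (pdvdMl p_pr _ yk); apply: rpred_nat.
split.
- have -> : z1 = z1 + 20 * 1%:R * y - 20 * y by ring.
  exact: rpredB (pdvdW p_pr (leqnSn _) L1) (nat_pdvd _).
- have -> : z2 = z2 + 20 * 2 * y - 40 * y by ring.
  exact: rpredB (pdvdW p_pr (leqnSn _) L2) (nat_pdvd _).
- have -> : 8 * z1 - z2 + 120 * y = 8 * (z1 + 20 * 1%:R * y) - (z2 + 20 * 2 * y) by ring.
  by apply: rpredB L2; apply: (pdvdMl p_pr _ L1); apply: rpred_nat.
Qed.

Theorem theorem4 (p r : nat) (p_prime : prime p) (p_gt5 : (5 < p)%N)
    (r_gt0 : (0 < r)%N) :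
  let S : rat :=
    @sum5 p (2 * p ^ r) (fun i => (-1) ^+ (i 0%R : nat))
    + 2 * @sum5 p (2 * p ^ r) (fun i => (-1) ^+ (i 0%R + i 1%R)%N) in
  (r = 1%N -> eqmodpq p 1 S (12 * bernoulli (p - 5))) /\
  ((1 < r)%N ->
     eqmodpq p r S (6 * (p ^ r.-1)%:R * bernoulli (p - 5))).
Proof.
move=> S.
have p_odd : odd p by case: (even_prime p_prime) p_gt5 => // ->.
have c5 : coprime 5 p by apply: coprime_small.
have i2 : 2^-1 \in pint p by apply: (@pint_invn p 2); rewrite coprime2n.
have SE : 5 * S = Zsum p (p ^ r) / 2 - Zsum p (2 * p ^ r) by apply: sum5_signs.
move: S SE => S SE; split=> [r1|r_gt1].
  change (S - 12 * bernoulli (p - 5) \in pdvd p 1).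
  apply: (@pdvd_cancel p p_prime 1 5 _ c5).
  have Z1 := Zsum_p_mod p_prime p_gt5; have Z2 := Zsum_2p_mod p_prime p_gt5.
  rewrite mulrBr SE r1 expn1.
  move: (bernoulli _) (Zsum p p) (Zsum p (2 * p)) Z1 Z2 => B z1 z2 Z1 Z2.
  (* The constant is -24/2 + 72 = 5 * 12. *)
  have -> : z1 / 2 - z2 - 5 * (12 * B) = 2^-1 * (z1 + 24 * B) - (z2 + 72 * B) by field.
  exact: rpredB (pdvdMl p_prime i2 Z1) Z2.
change (S - 6 * (p ^ r.-1)%:R * bernoulli (p - 5) \in pdvd p r).
apply: (@pdvd_cancel p p_prime r 5 _ c5).
rewrite mulrBr SE; case: r r_gt1 {r_gt0 SE} => [|[|k]] // _.
have [Z1 Z2 Z12] := Zsum_invariant k p_prime p_gt5.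
have L1 := @Zsum_lift p k 1 p_prime p_gt5 Z1 Z2 Z12; rewrite mul1n in L1.
have L2 := @Zsum_lift p k 2 p_prime p_gt5 Z1 Z2 Z12.
rewrite -[6 * _ * _]mulrA [k.+2.-1]/=.
move: L1 L2 {Z1 Z2 Z12}; move: ((p ^ k.+1)%:R * bernoulli _).
move: (Zsum p (p ^ k.+2)) (Zsum p (2 * p ^ k.+2)).
move=> z1 z2 y L1 L2.
(* The constant is -20/2 + 40 = 5 * 6: for r > 1 the multiples -20 and -40 replace the -24 and -72
   of r = 1, hence the two cases. *)
have -> : z1 / 2 - z2 - 5 * (6 * y)
   = 2^-1 * (z1 + 20 * 1%:R * y) - (z2 + 20 * 2 * y) by field.
exact: rpredB (pdvdMl p_prime i2 L1) L2.
Qed.
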